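(* For every $\varepsilon>0$ and every $k\in\mathbb{N}$ there exists $n\in\mathbb{N}$ such that the set $\{\mu\in\mathfrak{O}:|\mu|^2=n\}$ has more than $k$ elements, and every such $\mu$ lies on one of the six arcs $\{\sqrt n\,e^{i(\nu\pi/3+\varphi)}: |\varphi|<\varepsilon\}$, $\nu=0,1,\dots,5$.
   Context: $\omega=e^{i\pi/3}$ and $\mathfrak{O}=\mathbb{Z}[\omega]\subset\mathbb{C}$ (the hexagonal lattice). *)

(* Defs.v *)
From Stdlib Require Import Reals ZArith List.
From Coquelicot Require Import Coquelicot.
Open Scope R_scope.

Definition omega : C := (cos (PI / 3), sin (PI / 3)).

Definition in_O (z : C) : Prop :=
  exists a b : Z, z = Cplus (RtoC (IZR a)) (Cmult (RtoC (IZR b)) omega).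

Definition cis (t : R) : C := (cos t, sin t).

Definition on_six_arcs (eps : R) (n : nat) (z : C) : Prop :=
  exists nu : nat, (nu <= 5)%nat /\
    exists phi : R, Rabs phi < eps /\
      z = Cmult (RtoC (sqrt (INR n))) (cis (INR nu * PI / 3 + phi)).

(* Main.v *)
(** The arguments of the lattice points of norm [N(p)^k], for a prime [p] of [Z[omega]], are
    [j phi / 6 + nu pi / 3] with [|j| <= k], where [phi = 6 arg p] mod [2 pi]. So it suffices to
    find a prime with [phi] nonzero and arbitrarily small.

    Let [chi(x) = (x / |x|)^6]. For [m >= 1] the series [L_m(s)] of [chi^m(x) N(x)^(-s)] stays
    bounded as [s -> 1+]: writing [x = b y + j] with [j] running over residues modulo a fixed [b]
    with [chi^m(b) <> 1], and replacing [b y + j] by [b y], costs [O(|y|^(-3))] per term, so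
    [L_m(s) = N(b)^(1-s) chi^m(b) L_m(s) + O(1)]. Meanwhile [L_0(s) -> oo]. By the Euler product
    (applied to a finite set [P] of primes, after which essentially only the six units remain),
    the sums of [Re chi^m(p) N(p)^(-s)] over [P] are bounded above for [m >= 1] while the sums of
    [N(p)^(-s)] are not bounded.

    Upper bounds alone are enough, and nonvanishing of [L_m(1)] is not needed: the polynomial
    [(2 + 2 cos x)^M ((M + 2) cos x - (M + 1))] has nonnegative cosine coefficients except for a
    negative constant term of order [4^M] up to a power of [M], is positive at [0], and is
    exponentially smaller than [4^M] away from [0]. If no prime had small nonzero [phi], averaging
    it over [P] would contradict these bounds. *)
Require Import Defs.
From Stdlib Require Import Reals ZArith List Permutation Lra Lia Psatz Classical ClassicalEpsilon.
From Coquelicot Require Import Coquelicot.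
Open Scope R_scope.

(** * Unordered sums *)

(** Primes with [phi = 0], such as the rational primes that stay prime, cannot be discarded, so the
    polynomial must not be negative at 0. Since the character sums are bounded only from above, its
    nonconstant coefficients must not be negative either. The factor [(M + 2) cos x - (M + 1)] just
    meets both demands: it equals 1 at 0, and the constant term of the product is minus the [M]-th
    Catalan number.

    The contradiction comes from the order of choices. First [M] is fixed, so that the minimum of
    the polynomial away from 0 is negligible against that constant term; this fixes one bound [K]
    for the characters [1 <= m <= M + 1]. Only then are [s] and [P] taken with [W], the sum of
    [N(p)^(-s)] over [P], as large as desired. The weighted sum of the polynomial over [P] is at
    most a constant minus [h W], and at least [-(h / 2) W] if no prime has small nonzero [phi].

    One prime with small nonzero [phi] gives enough points: the [k + 1] products of [a] factors [p]
    and [k - a] factors [conj p] share a norm, and they are distinct because six times their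
    argument differences, taken modulo [2 pi], are nonzero multiples of [2 phi] that can be halved
    and still do not wrap around. *)

Definition csum {T : Type} (g : T -> C) (l : list T) : C :=
  fold_right (fun x s => Cplus (g x) s) (RtoC 0) l.

Definition rsum {T : Type} (g : T -> R) (l : list T) : R :=
  fold_right (fun x s => g x + s) 0 l.

Lemma csum_app {T} (g : T -> C) l l' : csum g (l ++ l') = (csum g l + csum g l')%C.
Proof. induction l as [|x l IH]; simpl; [ring | rewrite IH; ring]. Qed.

Lemma rsum_app {T} (g : T -> R) l l' : rsum g (l ++ l') = rsum g l + rsum g l'.
Proof. induction l as [|x l IH]; simpl; [ring | rewrite IH; ring]. Qed.

Lemma csum_perm {T} (g : T -> C) l l' : Permutation l l' -> csum g l = csum g l'.
Proof. induction 1; simpl; try congruence; ring. Qed.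

Lemma csum_plus {T} (g h : T -> C) l :
  csum (fun x => g x + h x)%C l = (csum g l + csum h l)%C.
Proof. induction l as [|x l IH]; simpl; [ring | rewrite IH; ring]. Qed.

Lemma csum_scal {T} (c : C) (g : T -> C) l :
  csum (fun x => c * g x)%C l = (c * csum g l)%C.
Proof. induction l as [|x l IH]; simpl; [ring | rewrite IH; ring]. Qed.

Lemma rsum_plus {T} (g h : T -> R) l : rsum (fun x => g x + h x) l = rsum g l + rsum h l.
Proof. induction l as [|x l IH]; simpl; [ring | rewrite IH; ring]. Qed.

Lemma rsum_scal {T} (c : R) (g : T -> R) l : rsum (fun x => c * g x) l = c * rsum g l.
Proof. induction l as [|x l IH]; simpl; [ring | rewrite IH; ring]. Qed.

Lemma csum_ext {T} (g h : T -> C) l : (forall x, In x l -> g x = h x) -> csum g l = csum h l.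
Proof.
  induction l as [|x l IH]; simpl; intros H; auto.
  rewrite IH, (H x); auto.
Qed.

Lemma csum_0 {T} (g : T -> C) l : (forall x, In x l -> g x = RtoC 0) -> csum g l = RtoC 0.
Proof.
  induction l as [|x l IH]; simpl; intros H; auto.
  rewrite IH, (H x); auto. ring.
Qed.

Lemma rsum_ext {T} (g h : T -> R) l : (forall x, In x l -> g x = h x) -> rsum g l = rsum h l.
Proof.
  induction l as [|x l IH]; simpl; intros H; auto.
  rewrite IH, (H x); auto.
Qed.

Lemma rsum_le {T} (g h : T -> R) l :
  (forall x, In x l -> g x <= h x) -> rsum g l <= rsum h l.
Proof.
  induction l as [|x l IH]; simpl; intros H; [lra|].
  apply Rplus_le_compat; auto.
Qed.

Lemma rsum_nonneg {T} (g : T -> R) l : (forall x, In x l -> 0 <= g x) -> 0 <= rsum g l.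
Proof.
  induction l as [|x l IH]; simpl; intros H; [lra|].
  apply Rplus_le_le_0_compat; auto.
Qed.

Lemma rsum_map {T U} (g : U -> R) (f : T -> U) l : rsum g (map f l) = rsum (fun x => g (f x)) l.
Proof. induction l as [|x l IH]; simpl; [auto | rewrite IH; auto]. Qed.

Lemma rsum_const {T} (c : R) (l : list T) : rsum (fun _ => c) l = INR (length l) * c.
Proof.
  induction l as [|x l IH]; [simpl; ring|].
  change (length (x :: l)) with (S (length l)); rewrite S_INR; simpl; rewrite IH; ring.
Qed.

Lemma Cmod_csum_le {T} (g : T -> C) l : Cmod (csum g l) <= rsum (fun x => Cmod (g x)) l.
Proof.
  induction l as [|x l IH]; simpl; [rewrite Cmod_0; lra|].
  eapply Rle_trans; [apply Cmod_triangle | lra].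
Qed.

Lemma csum_RtoC {T} (g : T -> R) l : csum (fun x => RtoC (g x)) l = RtoC (rsum g l).
Proof. induction l as [|x l IH]; simpl; [auto | rewrite IH, RtoC_plus; auto]. Qed.

Lemma NoDup_incl_split {T} (l0 l : list T) :
  NoDup l0 -> NoDup l -> incl l0 l ->
  exists l1, Permutation l (l0 ++ l1) /\ NoDup l1 /\ (forall x, In x l1 -> ~ In x l0).
Proof.
  revert l; induction l0 as [|x l0 IH]; intros l H0 Hl Hi.
  - exists l; repeat split; auto.
  - inversion H0 as [|? ? Hx H0']; subst.
    destruct (in_split x l (Hi x (or_introl eq_refl))) as (u & v & ->).
    destruct (IH (u ++ v)) as (l1 & P1 & N1 & D1); auto.
    + eapply NoDup_remove_1; eauto.
    + intros y Hy. assert (In y (u ++ x :: v)) by (apply Hi; right; auto).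
      apply in_app_or in H as [|[|]]; subst; try tauto; apply in_or_app; auto.
    + exists l1; split; [|split; auto].
      * simpl; rewrite <- P1; symmetry; apply Permutation_middle.
      * intros y Hy [->|Hy0]; [|eapply D1; eauto].
        apply NoDup_remove_2 in Hl; apply Hl.
        eapply Permutation_in; [symmetry; apply P1|]. apply in_or_app; auto.
Qed.

Lemma rsum_incl {T} (g : T -> R) l l' :
  (forall x, 0 <= g x) -> NoDup l -> incl l l' -> rsum g l <= rsum g l'.
Proof.
  intros Hg; revert l'; induction l as [|x l IH]; intros l' Hl Hi; simpl.
  - apply rsum_nonneg; auto.
  - inversion Hl as [|? ? Hx Hl']; subst.
    destruct (in_split x l' (Hi x (or_introl eq_refl))) as (u & v & ->).
    rewrite rsum_app; simpl.
    assert (rsum g l <= rsum g (u ++ v)) as H.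
    { apply IH; auto. intros y Hy.
      assert (In y (u ++ x :: v)) as Hy' by (apply Hi; right; auto).
      apply in_app_or in Hy' as [|[|]]; subst; try tauto; apply in_or_app; auto. }
    rewrite rsum_app in H; lra.
Qed.

Lemma classical_eq_dec {T} (x y : T) : {x = y} + {x <> y}.
Proof. apply excluded_middle_informative. Qed.

Lemma incl_NoDup_hull {T} (l : list T) : exists l', NoDup l' /\ forall x, In x l' <-> In x l.
Proof.
  exists (nodup classical_eq_dec l); split; [apply NoDup_nodup|].
  intros x; apply nodup_In.
Qed.

(** Convergence along finite subsets: no enumeration of the lattice is chosen, so splitting into
    residue classes and reindexing by a multiplication need no rearrangement argument. *)
Definition has_sum {T : Type} (g : T -> C) (L : C) : Prop :=
  forall e, 0 < e -> exists l0, forall l, NoDup l -> incl l0 l -> Cmod (csum g l - L) < e.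

Lemma has_sum_ext {T} (g h : T -> C) L : (forall x, g x = h x) -> has_sum g L -> has_sum h L.
Proof.
  intros E H e He. destruct (H e He) as (l0 & Hl0). exists l0; intros l Nl Il.
  rewrite <- (csum_ext g h) by auto. auto.
Qed.

Lemma has_sum_plus {T} (g h : T -> C) L M :
  has_sum g L -> has_sum h M -> has_sum (fun x => g x + h x)%C (L + M)%C.
Proof.
  intros Hg Hh e He.
  destruct (Hg (e/2)) as (l1 & H1); [lra|]. destruct (Hh (e/2)) as (l2 & H2); [lra|].
  exists (l1 ++ l2); intros l Nl Il. apply incl_app_inv in Il as [I1 I2].
  specialize (H1 l Nl I1); specialize (H2 l Nl I2).
  rewrite csum_plus.
  replace (csum g l + csum h l - (L + M))%C with ((csum g l - L) + (csum h l - M))%C by ring.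
  eapply Rle_lt_trans; [apply Cmod_triangle | lra].
Qed.

Lemma has_sum_scal {T} (c : C) (g : T -> C) L :
  has_sum g L -> has_sum (fun x => c * g x)%C (c * L)%C.
Proof.
  intros Hg e He. pose proof (Cmod_ge_0 c) as Hc.
  destruct (Hg (e / (Cmod c + 1))) as (l0 & H0).
  { apply Rdiv_lt_0_compat; lra. }
  exists l0; intros l Nl Il. specialize (H0 l Nl Il).
  rewrite csum_scal.
  replace (c * csum g l - c * L)%C with (c * (csum g l - L))%C by ring.
  rewrite Cmod_mult. pose proof (Cmod_ge_0 (csum g l - L)) as Hm.
  apply (Rmult_lt_compat_r (Cmod c + 1)) in H0; [|lra].
  unfold Rdiv in H0; rewrite Rmult_assoc, Rinv_l in H0; nra.
Qed.

Lemma has_sum_minus {T} (g h : T -> C) L M :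
  has_sum g L -> has_sum h M -> has_sum (fun x => g x - h x)%C (L - M)%C.
Proof.
  intros Hg Hh.
  replace (L - M)%C with (L + (-(1)) * M)%C by ring.
  apply (has_sum_ext (fun x => g x + (-(1)) * h x)%C); [intros; ring|].
  apply has_sum_plus; auto. apply has_sum_scal; auto.
Qed.

Lemma Cmod_eq_of_small (z w : C) : (forall e, 0 < e -> Cmod (z - w) < e) -> z = w.
Proof.
  intros H. destruct (Req_dec (Cmod (z - w)) 0) as [E|E].
  - apply Cmod_eq_0 in E. replace z with ((z - w) + w)%C by ring. rewrite E; ring.
  - pose proof (Cmod_ge_0 (z - w)). specialize (H (Cmod (z - w))). lra.
Qed.

Lemma has_sum_unique {T} (g : T -> C) L M : has_sum g L -> has_sum g M -> L = M.
Proof.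
  intros H1 H2. apply Cmod_eq_of_small; intros e He.
  destruct (H1 (e/2)) as (l1 & K1); [lra|]. destruct (H2 (e/2)) as (l2 & K2); [lra|].
  destruct (incl_NoDup_hull (l1 ++ l2)) as (l & Nl & Il).
  specialize (K1 l Nl); specialize (K2 l Nl).
  replace (L - M)%C with (- (csum g l - L) + (csum g l - M))%C by ring.
  eapply Rle_lt_trans; [apply Cmod_triangle|]. rewrite Cmod_opp.
  assert (Cmod (csum g l - L) < e/2) by (apply K1; intros x Hx; apply Il, in_or_app; auto).
  assert (Cmod (csum g l - M) < e/2) by (apply K2; intros x Hx; apply Il, in_or_app; auto).
  lra.
Qed.

Lemma has_sum_tail {T} (g : T -> C) L K l0 :
  NoDup l0 -> has_sum g L ->
  (forall l, NoDup l -> (forall x, In x l -> ~ In x l0) -> Cmod (csum g l) <= K) ->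
  Cmod (L - csum g l0) <= K.
Proof.
  intros N0 H B. apply le_epsilon; intros e He.
  destruct (H e He) as (l1 & K1).
  destruct (incl_NoDup_hull (l0 ++ l1)) as (l & Nl & Il).
  assert (Cmod (csum g l - L) < e) as A1.
  { apply K1; auto; intros x Hx; apply Il, in_or_app; auto. }
  destruct (NoDup_incl_split l0 l) as (l2 & P2 & N2 & D2); auto.
  { intros x Hx; apply Il, in_or_app; auto. }
  rewrite (csum_perm _ _ _ P2), csum_app in A1.
  replace (L - csum g l0)%C with (csum g l2 + - (csum g l0 + csum g l2 - L))%C by ring.
  eapply Rle_trans; [apply Cmod_triangle|]. rewrite Cmod_opp.
  specialize (B l2 N2 D2). lra.
Qed.

Lemma has_sum_bound {T} (g : T -> C) L (G : T -> R) K :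
  has_sum g L -> (forall x, Cmod (g x) <= G x) ->
  (forall l, NoDup l -> rsum G l <= K) -> Cmod L <= K.
Proof.
  intros H D B. replace L with (L - csum g nil)%C by (simpl; ring).
  apply has_sum_tail; auto; [constructor|].
  intros l Nl _. eapply Rle_trans; [apply Cmod_csum_le|].
  eapply Rle_trans; [|apply (B l Nl)]. apply rsum_le; auto.
Qed.

Lemma nonneg_sup {T} (G : T -> R) K :
  (forall x, 0 <= G x) -> (forall l, NoDup l -> rsum G l <= K) ->
  exists s, (forall l, NoDup l -> rsum G l <= s) /\
    forall e, 0 < e -> exists l0, NoDup l0 /\ s - e < rsum G l0.
Proof.
  intros Hg B.
  destruct (completeness (fun x => exists l, NoDup l /\ x = rsum G l)) as (s & U & S).
  - exists K. intros x (l & Nl & ->); auto.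
  - exists 0, nil; split; [constructor|auto].
  - exists s; split.
    + intros l Nl; apply U; eauto.
    + intros e He. apply NNPP; intros C.
      assert (s <= s - e); [|lra].
      apply S. intros x (l & Nl & ->). apply Rnot_lt_le; intros Hlt. apply C; eauto.
Qed.

Lemma nonneg_tail {T} (G : T -> R) K e :
  (forall x, 0 <= G x) -> (forall l, NoDup l -> rsum G l <= K) -> 0 < e ->
  exists l0, NoDup l0 /\
    forall l, NoDup l -> (forall x, In x l -> ~ In x l0) -> rsum G l <= e.
Proof.
  intros Hg B He. destruct (nonneg_sup G K Hg B) as (s & U & S).
  destruct (S e He) as (l0 & N0 & H0). exists l0; split; auto.
  intros l Nl D. assert (rsum G (l ++ l0) <= s) as H.
  { apply U. apply NoDup_app; auto. }
  rewrite rsum_app in H; lra.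
Qed.

Lemma has_sum_nonneg {T} (G : T -> R) K :
  (forall x, 0 <= G x) -> (forall l, NoDup l -> rsum G l <= K) ->
  exists s, has_sum (fun x => RtoC (G x)) (RtoC s) /\ forall l, NoDup l -> rsum G l <= s.
Proof.
  intros Hg B. destruct (nonneg_sup G K Hg B) as (s & U & S).
  exists s; split; auto. intros e He. destruct (S e He) as (l0 & N0 & H0).
  exists l0; intros l Nl Il. rewrite csum_RtoC, <- RtoC_minus, Cmod_R.
  pose proof (U l Nl). pose proof (rsum_incl G l0 l Hg N0 Il).
  apply Rabs_def1; lra.
Qed.

Lemma has_sum_dominated {T} (g : T -> C) (G : T -> R) K :
  (forall x, Cmod (g x) <= G x) -> (forall l, NoDup l -> rsum G l <= K) ->
  exists L, has_sum g L.
Proof.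
  intros D B.
  assert (G0 : forall x, 0 <= G x) by (intros x; eapply Rle_trans; [apply Cmod_ge_0 | apply D]).
  assert (re_bound : forall x, Rabs (Re (g x)) <= G x).
  { intros x. eapply Rle_trans; [|apply D].
    eapply Rle_trans; [apply Rmax_l | apply Rmax_Cmod]. }
  assert (im_bound : forall x, Rabs (Im (g x)) <= G x).
  { intros x. eapply Rle_trans; [|apply D].
    eapply Rle_trans; [apply Rmax_r | apply Rmax_Cmod]. }
  (* A signed [p] with [|p| <= G] is the difference of the nonnegative summable functions [p + G]
     and [G]. *)
  assert (shifted : forall p : T -> R, (forall x, Rabs (p x) <= G x) ->
            exists s, has_sum (fun x => RtoC (p x)) s).
  { intros p Hp.
    destruct (has_sum_nonneg G K G0 B) as (s & Hs & _).
    destruct (has_sum_nonneg (fun x => p x + G x) (K + K)) as (s' & Hs' & _).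
    - intros x. specialize (Hp x). apply Rabs_le_between in Hp. lra.
    - intros l Nl. rewrite rsum_plus.
      assert (rsum p l <= rsum G l).
      { apply rsum_le; intros x _. specialize (Hp x). apply Rabs_le_between in Hp. lra. }
      specialize (B l Nl). lra.
    - eexists. eapply has_sum_ext; [|apply (has_sum_minus _ _ _ _ Hs' Hs)].
      intros x; simpl. rewrite <- RtoC_minus. f_equal; ring. }
  destruct (shifted _ re_bound) as (a & Ha). destruct (shifted _ im_bound) as (b & Hb).
  exists (a + Ci * b)%C.
  eapply has_sum_ext; [|apply has_sum_plus; [apply Ha | apply (has_sum_scal Ci), Hb]].
  intros x; simpl. destruct (g x) as [u v].
  unfold Cplus, Cmult, Ci, RtoC, Re, Im; simpl; f_equal; ring.
Qed.

Lemma preimage_list {T U} (f : T -> U) (g : U -> C) (l : list U) :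
  (forall x y, f x = f y -> x = y) -> (forall u, (forall t, u <> f t) -> g u = RtoC 0) ->
  NoDup l ->
  exists l', NoDup l' /\ (forall t, In t l' <-> In (f t) l) /\
    csum (fun t => g (f t)) l' = csum g l.
Proof.
  intros Hinj H0; induction l as [|u l IH]; intros Nl.
  - exists nil; split; [constructor|]; split; [tauto|auto].
  - inversion Nl as [|? ? Hu Nl']; subst. destruct (IH Nl') as (l' & N' & I' & S').
    destruct (classic (exists t, u = f t)) as [(t & ->)|Hn].
    + exists (t :: l'); split; [|split].
      * constructor; auto. rewrite I'; auto.
      * intros t'; simpl; rewrite I'. split; intros [E|E]; auto.
        left; congruence.
      * simpl; rewrite S'; auto.
    + exists l'; split; [|split]; auto.
      * intros t; simpl; rewrite I'. split; auto. intros [E|E]; auto.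
        exfalso; apply Hn; eauto.
      * simpl; rewrite S', H0; [ring|]. intros t E; apply Hn; eauto.
Qed.

(** Serves to view a sum over a residue class, or over the multiples of a prime, as a sum over the
    whole lattice. *)
Lemma has_sum_push {T U} (f : T -> U) (g : U -> C) L :
  (forall x y, f x = f y -> x = y) -> (forall u, (forall t, u <> f t) -> g u = RtoC 0) ->
  has_sum (fun t => g (f t)) L -> has_sum g L.
Proof.
  intros Hinj H0 H e He. destruct (H e He) as (l0 & K0).
  exists (map f l0); intros l Nl Il.
  destruct (preimage_list f g l Hinj H0 Nl) as (l' & N' & I' & <-).
  apply K0; auto. intros t Ht. apply I', Il, in_map; auto.
Qed.

Lemma has_sum_csum_near {T J} (g : J -> T -> C) (A : C) (K : R) (js : list J) :
  (forall j, In j js -> exists L, has_sum (g j) L /\ Cmod (L - A) <= K) ->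
  exists S, has_sum (fun x => csum (fun j => g j x) js) S /\
    Cmod (S - RtoC (INR (length js)) * A) <= INR (length js) * K.
Proof.
  induction js as [|j js IH]; intros H.
  - exists (RtoC 0); split.
    + intros e He; exists nil; intros l _ _.
      rewrite (csum_0 _ l) by auto.
      replace (RtoC 0 - RtoC 0)%C with (RtoC 0) by ring. rewrite Cmod_0; auto.
    + simpl. replace (RtoC 0 - RtoC 0 * A)%C with (RtoC 0) by ring. rewrite Cmod_0; lra.
  - destruct IH as (S & HS & BS); [intros; apply H; right; auto|].
    destruct (H j) as (L & HL & BL); [left; auto|].
    exists (L + S)%C; split; [apply has_sum_plus; auto|].
    change (length (j :: js)) with (Datatypes.S (length js)). rewrite S_INR, RtoC_plus.
    replace (L + S - (RtoC (INR (length js)) + RtoC 1) * A)%C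
      with ((L - A) + (S - RtoC (INR (length js)) * A))%C by ring.
    eapply Rle_trans; [apply Cmod_triangle | lra].
Qed.

Lemma csum_single {T} (g : T -> C) l j :
  NoDup l -> In j l -> (forall i, In i l -> i <> j -> g i = RtoC 0) -> csum g l = g j.
Proof.
  intros Nl Hj H0. induction Nl as [|i l Hi Nl IH]; [destruct Hj|]. simpl.
  destruct Hj as [->|Hj].
  - rewrite csum_0; [ring|]. intros x Hx. apply H0; [right; auto|]. intros ->; tauto.
  - rewrite IH, H0; auto; [ring|left; auto | | ].
    + intros ->; tauto.
    + intros x Hx; apply H0; right; auto.
Qed.

(** * Arithmetic of Eisenstein integers *)

(* The pair [(a, b)] stands for [a + b omega]; recall [omega ^ 2 = omega - 1]. *)
Definition E : Type := (Z * Z)%type.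

Definition e0 : E := (0, 0)%Z.
Definition e1 : E := (1, 0)%Z.
Definition eadd (x y : E) : E := (fst x + fst y, snd x + snd y)%Z.
Definition eopp (x : E) : E := (- fst x, - snd x)%Z.
Definition emul (x y : E) : E :=
  (fst x * fst y - snd x * snd y, fst x * snd y + snd x * fst y + snd x * snd y)%Z.
Definition econj (x : E) : E := (fst x + snd x, - snd x)%Z.
Definition enorm (x : E) : Z := (fst x * fst x + fst x * snd x + snd x * snd x)%Z.
Definition edvd (x y : E) : Prop := exists z, y = emul x z.

Ltac ering :=
  intros; repeat match goal with x : E |- _ => destruct x end;
  unfold e0, e1, eadd, eopp, emul, econj, enorm in *; simpl fst; simpl snd;
  try apply f_equal2; ring.

Lemma E_ring : ring_theory e0 e1 eadd emul (fun x y => eadd x (eopp y)) eopp eq.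
Proof. constructor; ering. Qed.
Add Ring E_ring : E_ring.

Lemma norm_mul x y : enorm (emul x y) = (enorm x * enorm y)%Z.
Proof. ering. Qed.

Lemma norm_conj x : enorm (econj x) = enorm x.
Proof. ering. Qed.

Lemma emul_conj x : emul x (econj x) = (enorm x, 0%Z).
Proof. ering. Qed.

Lemma econj_mul x y : econj (emul x y) = emul (econj x) (econj y).
Proof. ering. Qed.

Lemma econj_conj x : econj (econj x) = x.
Proof. ering. Qed.

(** Completing the square without denominators: positivity of the norm and the bounds on units
    follow. *)
Lemma four_norm x :
  (4 * enorm x = (2 * fst x + snd x) * (2 * fst x + snd x) + 3 * (snd x * snd x))%Z.
Proof. ering. Qed.

Lemma norm_nonneg (x : E) : (0 <= enorm x)%Z.
Proof.
  pose proof (four_norm x). pose proof (Z.square_nonneg (2 * fst x + snd x)).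
  pose proof (Z.square_nonneg (snd x)). lia.
Qed.

Lemma norm_eq_0 x : enorm x = 0%Z -> x = e0.
Proof.
  intros H. pose proof (four_norm x) as H4. rewrite H in H4.
  destruct x as [a b]; cbn [fst snd] in H4.
  pose proof (Z.square_nonneg (2 * a + b)). pose proof (Z.square_nonneg b).
  assert (b = 0)%Z by nia. subst b. assert (a = 0)%Z by nia. subst a. reflexivity.
Qed.

Lemma norm_pos x : x <> e0 -> (0 < enorm x)%Z.
Proof.
  intros H. pose proof (norm_nonneg x). assert (enorm x <> 0%Z); [|lia].
  intros E0; apply H, norm_eq_0, E0.
Qed.

Lemma emul_eq_0 x y : emul x y = e0 -> x = e0 \/ y = e0.
Proof.
  intros H. apply (f_equal enorm) in H. rewrite norm_mul in H.
  change (enorm e0) with 0%Z in H. apply Z.mul_eq_0 in H as [H|H]; apply norm_eq_0 in H; auto.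
Qed.

Lemma emul_cancel_l x y z : x <> e0 -> emul x y = emul x z -> y = z.
Proof.
  intros Hx H.
  assert (emul x (eadd y (eopp z)) = e0) as H0.
  { replace (emul x (eadd y (eopp z))) with (eadd (emul x y) (eopp (emul x z))) by ring.
    rewrite H; ring. }
  apply emul_eq_0 in H0 as [H0|H0]; [tauto|].
  replace y with (eadd (eadd y (eopp z)) z) by ring. rewrite H0; ring.
Qed.

Definition eunits : list E :=
  ((1, 0) :: (0, 1) :: (-1, 1) :: (-1, 0) :: (0, -1) :: (1, -1) :: nil)%Z.

Lemma norm_1_units x : enorm x = 1%Z <-> In x eunits.
Proof.
  split.
  - intros H. pose proof (four_norm x) as H4. rewrite H in H4.
    destruct x as [a b]; cbn [fst snd] in H4.
    pose proof (Z.square_nonneg (2 * a + b)).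
    assert (-1 <= b <= 1)%Z by nia. assert (-1 <= a <= 1)%Z by nia.
    assert (b = -1 \/ b = 0 \/ b = 1)%Z as Hb by lia.
    assert (a = -1 \/ a = 0 \/ a = 1)%Z as Ha by lia.
    destruct Ha as [->|[->| ->]], Hb as [->|[->| ->]];
      unfold enorm in H; simpl in H; try lia; simpl; tauto.
  - simpl; intros [<-|[<-|[<-|[<-|[<-|[<-|[]]]]]]]; reflexivity.
Qed.

Lemma edvd_trans x y z : edvd x y -> edvd y z -> edvd x z.
Proof. intros (u & ->) (v & ->). exists (emul u v); ring. Qed.

Lemma edvd_refl x : edvd x x.
Proof. exists e1; ring. Qed.

Lemma edvd_norm_1 u x : enorm u = 1%Z -> edvd u x.
Proof.
  intros H. exists (emul (econj u) x).
  replace (emul u (emul (econj u) x)) with (emul (emul u (econj u)) x) by ring.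
  rewrite emul_conj, H. change (1, 0)%Z with e1. ring.
Qed.

Lemma nearest_div (x n : Z) : (0 < n)%Z -> exists q, (-n <= 2 * (x - n * q) <= n)%Z.
Proof.
  intros Hn. exists ((2 * x + n) / (2 * n))%Z.
  pose proof (Z.div_mod (2 * x + n) (2 * n)). pose proof (Z.mod_pos_bound (2 * x + n) (2 * n)).
  lia.
Qed.

(** Round both coordinates of [x conj(y) / N(y)] to nearest integers. The errors are at most 1/2, so
    the remainder has norm at most [3/4 N(y)]. *)
Lemma euclid x y : y <> e0 -> exists q, (enorm (eadd x (eopp (emul y q))) < enorm y)%Z.
Proof.
  intros Hy. pose proof (norm_pos y Hy) as Hn.
  destruct (nearest_div (fst (emul x (econj y))) (enorm y) Hn) as (q1 & H1).
  destruct (nearest_div (snd (emul x (econj y))) (enorm y) Hn) as (q2 & H2).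
  exists (q1, q2).
  assert (enorm y * enorm (eadd x (eopp (emul y (q1, q2)))) =
    enorm (fst (emul x (econj y)) - enorm y * q1, snd (emul x (econj y)) - enorm y * q2))%Z as K.
  { clear. ering. }
  set (u := (fst (emul x (econj y)) - enorm y * q1)%Z) in *.
  set (v := (snd (emul x (econj y)) - enorm y * q2)%Z) in *.
  assert (enorm (u, v) < enorm y * enorm y)%Z.
  { unfold enorm at 1; cbn [fst snd].
    pose proof (Z.mul_nonneg_nonneg (enorm y - 2 * u) (enorm y + 2 * u)).
    pose proof (Z.mul_nonneg_nonneg (enorm y - 2 * v) (enorm y + 2 * v)).
    pose proof (Z.square_nonneg (u - v)). nia. }
  nia.
Qed.

Lemma norm_minimal (Q : E -> Prop) :
  (exists x, Q x) -> exists x, Q x /\ forall y, Q y -> (enorm x <= enorm y)%Z.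
Proof.
  intros (x & Hx). remember (Z.to_nat (enorm x)) as n eqn:En.
  revert x Hx En. induction n as [n IH] using lt_wf_ind; intros x Hx En.
  destruct (classic (exists y, Q y /\ (enorm y < enorm x)%Z)) as [(y & Hy & L)|H].
  - apply (IH (Z.to_nat (enorm y))) with (x := y); auto.
    pose proof (norm_nonneg y); lia.
  - exists x; split; auto. intros y Hy. apply Znot_gt_le; intros G; apply H; exists y; split; auto; lia.
Qed.

Definition eprime (p : E) : Prop :=
  p <> e0 /\ enorm p <> 1%Z /\ forall x y, edvd p (emul x y) -> edvd p x \/ edvd p y.

(* A nonunit divisor of least norm is prime: by minimality, its gcd with any
   element it does not divide is a unit. *)
Lemma prime_divisor x : x <> e0 -> enorm x <> 1%Z -> exists p, eprime p /\ edvd p x.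
Proof.
  intros Hx Hu.
  destruct (norm_minimal (fun p => edvd p x /\ enorm p <> 1%Z)) as (p & (Dp & Up) & Mp).
  { exists x; split; auto. apply edvd_refl. }
  assert (p <> e0) as P0.
  { intros ->. destruct Dp as (z & ->). apply Hx. ring. }
  exists p; split; auto. split; auto. split; auto.
  intros a b Hab. destruct (classic (edvd p a)) as [|Ha]; [auto|right].
  destruct (norm_minimal (fun d => d <> e0 /\ exists s t, d = eadd (emul s p) (emul t a)))
    as (d & (D0 & s & t & Ed) & Md).
  { exists p; split; auto. exists e1, e0; ring. }
  assert (forall c s' t', c = eadd (emul s' p) (emul t' a) -> edvd d c) as Dd.
  { intros c s' t' Ec. destruct (euclid c d D0) as (q & Hq).
    exists q. apply NNPP; intros Hne.
    apply (Zlt_not_le _ _ Hq). apply Md. split.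
    - intros K. apply Hne. replace c with (eadd (eadd c (eopp (emul d q))) (emul d q)) by ring.
      rewrite K; ring.
    - exists (eadd s' (eopp (emul s q))), (eadd t' (eopp (emul t q))).
      rewrite Ec, Ed. ring. }
  assert (edvd d p) as (e & Ep) by (apply (Dd p e1 e0); ring).
  assert (edvd d a) as Da by (apply (Dd a e0 e1); ring).
  destruct (Z.eq_dec (enorm d) 1) as [U|U].
  (* Here [d = s p + t a] is a unit and [b = d z]. Multiplying by [z] leaves [a z] to be treated,
     and [a z = conj(d) a b] is a multiple of [p]. *)
  - destruct (edvd_norm_1 d b U) as (z & ->). destruct Hab as (h & Hh).
    rewrite Ed.
    exists (eadd (emul s z) (emul t (emul (emul h (econj d)) e1))).
    replace (emul (eadd (emul s p) (emul t a)) z)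
      with (eadd (emul (emul s p) z) (emul t (emul a (emul (emul d (econj d)) z)))).
    + replace (emul a (emul (emul d (econj d)) z))
        with (emul (emul a (emul d z)) (econj d)) by ring.
      rewrite Hh. ring.
    + rewrite emul_conj, U. change (1, 0)%Z with e1. ring.
  - exfalso. apply Ha. apply edvd_trans with d; auto.
    assert (enorm p <= enorm d)%Z as Le.
    { apply Mp. split; auto. apply edvd_trans with p; auto. exists e; auto. }
    pose proof (norm_pos d D0) as Nd. pose proof (norm_pos p P0) as Np.
    assert (enorm p = (enorm d * enorm e)%Z) as Ne by (rewrite Ep at 1; apply norm_mul).
    assert (enorm e = 1%Z) as Ue by nia.
    exists (econj e). rewrite Ep.
    replace (emul (emul d e) (econj e)) with (emul d (emul e (econj e))) by ring.
    rewrite emul_conj, Ue. change (1, 0)%Z with e1. ring.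
Qed.

(** Pairwise nonassociate primes: for primes, divisibility in one direction already means being
    associate, so testing against the later entries is enough. *)
Inductive prime_list : list E -> Prop :=
| prime_list_nil : prime_list nil
| prime_list_cons p l : eprime p -> (forall q, In q l -> ~ edvd q p) -> prime_list l ->
    prime_list (p :: l).

Lemma prime_list_prime l p : prime_list l -> In p l -> eprime p.
Proof.
  induction 1 as [|q l Hq Hn Hl IH]; simpl; [tauto|]. intros [<-|]; auto.
Qed.

Lemma prime_list_NoDup l : prime_list l -> NoDup l.
Proof.
  induction 1 as [|q l Hq Hn Hl IH]; constructor; auto.
  intros Hi. apply (Hn q Hi). apply edvd_refl.
Qed.

(** One prime divisor per element suffices, so unique factorization never enters: a new prime is
    added only if no earlier one divides the element. *)
Lemma prime_list_cover (l : list E) :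
  exists P, prime_list P /\
    forall x, In x l -> x <> e0 -> enorm x <> 1%Z -> exists p, In p P /\ edvd p x.
Proof.
  induction l as [|x l (P & HP & C)].
  - exists nil; split; [constructor | simpl; tauto].
  - destruct (classic (exists q, In q P /\ edvd q x)) as [D|D].
    + exists P; split; auto. intros y [<-|Hy]; auto.
    + destruct (classic (x = e0)) as [X0|X0]; [exists P; split; auto; intros y [<-|Hy]; auto; tauto|].
      destruct (Z.eq_dec (enorm x) 1) as [U|U]; [exists P; split; auto; intros y [<-|Hy]; auto; tauto|].
      destruct (prime_divisor x X0 U) as (p & Pp & Dp).
      exists (p :: P); split.
      * constructor; auto. intros q Hq Dq. apply D. exists q; split; auto.
        eapply edvd_trans; eauto.
      * intros y [<-|Hy] H0 H1; [exists p; simpl; auto|].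
        destruct (C y Hy H0 H1) as (q & Hq & Dq). exists q; simpl; auto.
Qed.

(** * Embedding into the complex numbers and Hecke characters *)

Definition toC (x : E) : C := (RtoC (IZR (fst x)) + RtoC (IZR (snd x)) * omega)%C.

Lemma omega_eq : omega = (1 / 2, sqrt 3 / 2).
Proof. unfold omega. rewrite cos_PI3, sin_PI3. auto. Qed.

Lemma sqrt3_sqr : sqrt 3 * sqrt 3 = 3.
Proof. apply sqrt_sqrt; lra. Qed.

Lemma toC_pair x : toC x = (IZR (fst x) + IZR (snd x) / 2, IZR (snd x) * (sqrt 3 / 2)).
Proof.
  unfold toC; rewrite omega_eq. unfold Cplus, Cmult, RtoC; simpl. f_equal; field.
Qed.

Lemma toC_mul x y : toC (emul x y) = (toC x * toC y)%C.
Proof.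
  rewrite !toC_pair. destruct x as [a b], y as [c d]; unfold emul, Cmult; simpl.
  repeat rewrite ?plus_IZR, ?minus_IZR, ?mult_IZR. pose proof sqrt3_sqr as S. f_equal.
  - replace ((IZR a + IZR b / 2) * (IZR c + IZR d / 2) -
      IZR b * (sqrt 3 / 2) * (IZR d * (sqrt 3 / 2)))
      with ((IZR a + IZR b / 2) * (IZR c + IZR d / 2) -
        IZR b * IZR d / 4 * (sqrt 3 * sqrt 3)) by field.
    rewrite S; field.
  - field.
Qed.

Lemma toC_add x y : toC (eadd x y) = (toC x + toC y)%C.
Proof.
  rewrite !toC_pair. destruct x as [a b], y as [c d]; unfold eadd, Cplus; simpl.
  rewrite !plus_IZR. f_equal; field.
Qed.

Lemma toC_conj x : toC (econj x) = Cconj (toC x).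
Proof.
  rewrite !toC_pair. destruct x as [a b]; unfold econj, Cconj; simpl.
  rewrite plus_IZR, opp_IZR. f_equal; field.
Qed.

Lemma Cmod_toC_sqr x : Cmod (toC x) ^ 2 = IZR (enorm x).
Proof.
  rewrite Cmod2_alt, toC_pair. destruct x as [a b]; unfold enorm, Re, Im; simpl fst; simpl snd.
  repeat rewrite ?plus_IZR, ?mult_IZR.
  replace ((IZR b * (sqrt 3 / 2)) ^ 2) with (IZR b * IZR b / 4 * (sqrt 3 * sqrt 3)) by field.
  rewrite sqrt3_sqr; field.
Qed.

Lemma Cmod_toC_pos x : x <> e0 -> 0 < Cmod (toC x).
Proof.
  intros H. pose proof (Cmod_ge_0 (toC x)). pose proof (Cmod_toC_sqr x) as S.
  pose proof (IZR_lt _ _ (norm_pos x H)). nra.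
Qed.

Lemma norm_ge_1 x : x <> e0 -> 1 <= IZR (enorm x).
Proof. intros H. apply (IZR_le 1). pose proof (norm_pos x H). lia. Qed.

Lemma Cmod_toC_ge_1 x : x <> e0 -> 1 <= Cmod (toC x).
Proof.
  intros H. pose proof (Cmod_ge_0 (toC x)). pose proof (Cmod_toC_sqr x) as S.
  pose proof (norm_ge_1 x H). nra.
Qed.

Lemma toC_0 : toC e0 = RtoC 0.
Proof. rewrite toC_pair; unfold RtoC; simpl; f_equal; field. Qed.

Definition dir (z : C) : C := (z * RtoC (/ Cmod z))%C.

Lemma dir_mul z w : dir (z * w) = (dir z * dir w)%C.
Proof. unfold dir. rewrite Cmod_mult, Rinv_mult, RtoC_mult. ring. Qed.

Lemma Cmod_dir z : 0 < Cmod z -> Cmod (dir z) = 1.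
Proof.
  intros H. unfold dir. rewrite Cmod_mult, Cmod_R, Rabs_pos_eq.
  - apply Rinv_r; lra.
  - left; apply Rinv_0_lt_compat; auto.
Qed.

(* The exponent is a multiple of 6 so that [chi m] is trivial on units. *)
Definition chi (m : nat) (x : E) : C := (dir (toC x) ^ (6 * m))%C.

(** Zero is set apart because [Rpower 0 _] is 1 under the convention [ln 0 = 0]; the value 0 keeps
    [wt] multiplicative and drops the origin from all sums. *)
Definition wt (s : R) (x : E) : R :=
  if Z.eq_dec (enorm x) 0 then 0 else Rpower (IZR (enorm x)) (- s).

Definition heckef (m : nat) (s : R) (x : E) : C := (chi m x * RtoC (wt s x))%C.

Lemma chi_mul m x y : chi m (emul x y) = (chi m x * chi m y)%C.
Proof. unfold chi. rewrite toC_mul, dir_mul, Cpow_mult_l. auto. Qed.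

Lemma Cmod_chi m x : x <> e0 -> Cmod (chi m x) = 1.
Proof.
  intros H. unfold chi. rewrite Cmod_pow, Cmod_dir, pow1; auto. apply Cmod_toC_pos; auto.
Qed.

Lemma wt_0 s : wt s e0 = 0.
Proof. reflexivity. Qed.

Lemma wt_neq s x : x <> e0 -> wt s x = Rpower (IZR (enorm x)) (- s).
Proof.
  intros H. unfold wt. destruct (Z.eq_dec (enorm x) 0) as [Z0|]; auto.
  apply norm_eq_0 in Z0; tauto.
Qed.

Lemma Rpower_pos x y : 0 < Rpower x y.
Proof. apply exp_pos. Qed.

Lemma wt_nonneg s x : 0 <= wt s x.
Proof. unfold wt. destruct Z.eq_dec; [lra|]. left; apply Rpower_pos. Qed.

Lemma wt_mul s x y : wt s (emul x y) = wt s x * wt s y.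
Proof.
  destruct (classic (x = e0)) as [->|Hx].
  { replace (emul e0 y) with e0 by ring. rewrite wt_0; ring. }
  destruct (classic (y = e0)) as [->|Hy].
  { replace (emul x e0) with e0 by ring. rewrite wt_0; ring. }
  rewrite !wt_neq; auto.
  - rewrite norm_mul, mult_IZR, Rpower_mult_distr; auto; apply (IZR_lt 0), norm_pos; auto.
  - intros H; apply emul_eq_0 in H; tauto.
Qed.

Lemma heckef_mul m s x y : heckef m s (emul x y) = (heckef m s x * heckef m s y)%C.
Proof. unfold heckef. rewrite chi_mul, wt_mul, RtoC_mult. ring. Qed.

Lemma Cmod_heckef m s x : Cmod (heckef m s x) = wt s x.
Proof.
  unfold heckef. rewrite Cmod_mult, Cmod_R, Rabs_pos_eq by apply wt_nonneg.
  destruct (classic (x = e0)) as [->|Hx]; [rewrite wt_0; ring|].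
  rewrite Cmod_chi; auto; ring.
Qed.

Lemma heckef_0 m s : heckef m s e0 = RtoC 0.
Proof. unfold heckef. rewrite wt_0. ring. Qed.

Lemma Re_heckef m s x : Re (heckef m s x) = Re (chi m x) * wt s x.
Proof. unfold heckef. destruct (chi m x) as [u v]. simpl. ring. Qed.

Lemma Rpower_le_1 x y : 1 <= x -> y <= 0 -> Rpower x y <= 1.
Proof.
  intros Hx Hy. rewrite <- (Rpower_O x) by lra. apply Rle_Rpower; auto.
Qed.

Lemma wt_le_1 s x : 0 <= s -> wt s x <= 1.
Proof.
  intros H. destruct (classic (x = e0)) as [->|Hx]; [rewrite wt_0; lra|].
  rewrite wt_neq; auto. apply Rpower_le_1; [apply norm_ge_1; auto | lra].
Qed.

Lemma wt_antitone s t x : s <= t -> wt t x <= wt s x.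
Proof.
  intros H. destruct (classic (x = e0)) as [->|Hx]; [rewrite !wt_0; lra|].
  rewrite !wt_neq; auto. apply Rle_Rpower; [apply norm_ge_1; auto | lra].
Qed.

Lemma heckef_unit m s u : enorm u = 1%Z -> heckef m s u = RtoC 1.
Proof.
  intros H. unfold heckef. rewrite wt_neq.
  2:{ intros ->. discriminate. }
  rewrite H. replace (Rpower 1 (- s)) with 1.
  2:{ unfold Rpower. rewrite ln_1, Rmult_0_r, exp_0; auto. }
  assert (Cmod (toC u) = 1) as M.
  { pose proof (Cmod_toC_sqr u) as S. pose proof (Cmod_ge_0 (toC u)). rewrite H in S. nra. }
  unfold chi, dir. rewrite M, Rinv_1.
  replace (toC u * RtoC 1)%C with (toC u) by ring. rewrite Cpow_mult_r.
  replace (toC u ^ 6)%C with (RtoC 1); [rewrite Cpow_1_l; ring|].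
  assert (toC e1 = RtoC 1) as <- by (rewrite toC_pair; unfold RtoC; simpl; f_equal; field).
  assert (emul u (emul u (emul u (emul u (emul u u)))) = e1) as <-.
  { apply norm_1_units in H. simpl in H.
    destruct H as [<-|[<-|[<-|[<-|[<-|[<-|[]]]]]]]; reflexivity. }
  rewrite !toC_mul. simpl. ring.
Qed.

(** * Convergence for exponents above 1 *)

Lemma ln_le_sub_1 x : 0 < x -> ln x <= x - 1.
Proof.
  intros H. pose proof (exp_ineq1_le (ln x)) as K. rewrite exp_ln in K; lra.
Qed.

(** Stands in for comparison with the integral of [t^(-s)]: with [y = x + 1], the ratio
    [(x / y)^(1 - s)] is at least [1 + (s - 1) (ln y - ln x)], and [ln y - ln x >= 1 / y]. *)
Lemma Rpower_telescope s x : 1 < s -> 0 < x ->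
  (s - 1) * Rpower (x + 1) (- s) <= Rpower x (1 - s) - Rpower (x + 1) (1 - s).
Proof.
  intros Hs Hx. set (y := x + 1). assert (0 < y) by (unfold y; lra).
  assert (Rpower x (1 - s) = Rpower y (1 - s) * exp ((s - 1) * (ln y - ln x))) as ->.
  { unfold Rpower. rewrite <- exp_plus. f_equal; ring. }
  assert (/ y <= ln y - ln x) as L.
  { pose proof (ln_le_sub_1 (x / y)) as K.
    assert (0 < x / y) by (apply Rdiv_lt_0_compat; auto).
    rewrite ln_div in K; auto.
    replace (/ y) with (1 - x / y) by (unfold y; field; lra).
    specialize (K H0); lra. }
  assert (Rpower y (- s) = Rpower y (1 - s) * / y) as ->.
  { replace (- s) with ((1 - s) + - (1)) by ring.
    rewrite Rpower_plus, Rpower_Ropp, Rpower_1; auto. }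
  pose proof (exp_ineq1_le ((s - 1) * (ln y - ln x))) as K.
  pose proof (Rpower_pos y (1 - s)) as P.
  assert ((s - 1) * / y <= exp ((s - 1) * (ln y - ln x)) - 1) by nra.
  nra.
Qed.

Lemma zeta_partial s n : 1 < s ->
  (s - 1) * rsum (fun i => Rpower (1 + INR i) (- s)) (seq 0 (S n)) <=
    s - Rpower (1 + INR n) (1 - s).
Proof.
  intros Hs. induction n as [|n IH].
  - simpl. rewrite !Rplus_0_r. unfold Rpower. rewrite ln_1, !Rmult_0_r, exp_0. lra.
  - rewrite seq_S, rsum_app, Rmult_plus_distr_l.
    change (rsum _ (0 + S n :: nil)%nat)
      with (Rpower (1 + INR (S n)) (- s) + 0).
    pose proof (pos_INR n).
    pose proof (Rpower_telescope s (1 + INR n) Hs ltac:(lra)) as T.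
    rewrite S_INR. rewrite Rplus_assoc in T. lra.
Qed.

Lemma zeta_bounded s n : 1 < s ->
  rsum (fun i => Rpower (1 + INR i) (- s)) (seq 0 n) <= s / (s - 1).
Proof.
  intros Hs. assert (0 <= s / (s - 1)).
  { apply Rlt_le, Rdiv_lt_0_compat; lra. }
  destruct n as [|n]; [simpl; auto|].
  pose proof (zeta_partial s n Hs). pose proof (Rpower_pos (1 + INR n) (1 - s)).
  apply (Rmult_le_reg_l (s - 1)); [lra|].
  replace ((s - 1) * (s / (s - 1))) with s by (field; lra). lra.
Qed.

Definition coord_wt (s : R) (a : Z) : R := Rpower (1 + IZR (Z.abs a)) (- s).

(** Zero is listed twice, which is harmless since boxes only serve for upper bounds. *)
Definition zbox (n : nat) : list Z :=
  map Z.of_nat (seq 0 n) ++ map (fun i => (- Z.of_nat i)%Z) (seq 0 n).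

Lemma zbox_In n a : (Z.abs a < Z.of_nat n)%Z -> In a (zbox n).
Proof.
  intros H. apply in_or_app. destruct (Z_le_dec 0 a).
  - left. apply in_map_iff. exists (Z.to_nat a). rewrite in_seq. lia.
  - right. apply in_map_iff. exists (Z.to_nat (- a)). rewrite in_seq. lia.
Qed.

Lemma coord_wt_bounded s n : 1 < s -> rsum (coord_wt s) (zbox n) <= 2 * (s / (s - 1)).
Proof.
  intros Hs. unfold zbox. rewrite rsum_app, !rsum_map.
  pose proof (zeta_bounded s n Hs) as Z.
  apply Rle_trans with (s / (s - 1) + s / (s - 1)); [|lra].
  apply Rplus_le_compat; (eapply Rle_trans; [right; apply rsum_ext|apply Z]);
    intros i _; unfold coord_wt; rewrite ?Z.abs_opp, Z.abs_eq, INR_IZR_INZ; auto; lia.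
Qed.

Lemma rsum_list_prod {T U} (f : T -> R) (g : U -> R) A B :
  rsum (fun p => f (fst p) * g (snd p)) (list_prod A B) = rsum f A * rsum g B.
Proof.
  induction A as [|a A IH]; simpl; [ring|].
  rewrite rsum_app, rsum_map, IH; simpl. rewrite rsum_scal. ring.
Qed.

Lemma list_in_box (l : list E) : exists n, incl l (list_prod (zbox n) (zbox n)).
Proof.
  assert (exists n, forall x, In x l ->
    (Z.abs (fst x) < Z.of_nat n)%Z /\ (Z.abs (snd x) < Z.of_nat n)%Z) as (n & Hn).
  { induction l as [|[a b] l (n & Hn)]; [exists O; simpl; tauto|].
    exists (S (n + Z.to_nat (Z.abs a) + Z.to_nat (Z.abs b))). intros x [<-|Hx]; simpl fst; simpl snd.
    - lia.
    - specialize (Hn x Hx). lia. }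
  exists n. intros [a b] Hx. apply in_prod; apply zbox_In; apply (Hn (a, b) Hx).
Qed.

(** Unlike [wt], positive at the origin: it must dominate the dilation error, which at [x = 0] is
    [heckef m s j] and need not vanish. *)
Definition wt1 (s : R) (x : E) : R :=
  if Z.eq_dec (enorm x) 0 then 1 else Rpower (IZR (enorm x)) (- s).

Lemma wt1_0 s : wt1 s e0 = 1.
Proof. reflexivity. Qed.

Lemma wt1_neq s x : x <> e0 -> wt1 s x = Rpower (IZR (enorm x)) (- s).
Proof.
  intros H. unfold wt1. destruct (Z.eq_dec (enorm x) 0) as [Z0|]; auto.
  apply norm_eq_0 in Z0; tauto.
Qed.

Lemma wt1_pos s x : 0 < wt1 s x.
Proof. unfold wt1. destruct Z.eq_dec; [lra|]. apply Rpower_pos. Qed.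

Lemma wt_le_wt1 s x : wt s x <= wt1 s x.
Proof. unfold wt, wt1. destruct Z.eq_dec; lra. Qed.

(** Bounding the norm below by a product of coordinates makes the double sum factor into two
    one-dimensional zeta sums, with no loss in the exponent. *)
Lemma box_le_norm x : x <> e0 ->
  ((1 + Z.abs (fst x)) * (1 + Z.abs (snd x)) <= 6 * enorm x)%Z.
Proof.
  intros H. pose proof (norm_pos x H) as P. destruct x as [a b].
  unfold enorm in *; cbn [fst snd] in *.
  clear H. pose proof (Z.square_nonneg (a - b)). pose proof (Z.square_nonneg (a + b)).
  assert (Z.abs a <= a * a)%Z by nia. assert (Z.abs b <= b * b)%Z by nia.
  assert (Z.abs a * Z.abs b <= a * a + a * b + b * b)%Z by (rewrite <- Z.abs_mul; lia).
  generalize dependent (Z.abs a); generalize dependent (Z.abs b); intros; lia.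
Qed.

Lemma wt1_le_coord s x : 0 <= s ->
  wt1 s x <= Rpower 6 s * (coord_wt s (fst x) * coord_wt s (snd x)).
Proof.
  intros Hs. unfold coord_wt.
  assert (P : forall a, 0 < 1 + IZR (Z.abs a)).
  { intros a. pose proof (IZR_le _ _ (Z.abs_nonneg a)). lra. }
  rewrite Rpower_mult_distr; auto.
  set (q := (1 + IZR (Z.abs (fst x))) * (1 + IZR (Z.abs (snd x)))).
  assert (0 < q) by (apply Rmult_lt_0_compat; auto).
  destruct (classic (x = e0)) as [->|Hx].
  - rewrite wt1_0. unfold q; simpl. rewrite Rplus_0_r, Rmult_1_l.
    unfold Rpower at 2. rewrite ln_1, Rmult_0_r, exp_0, Rmult_1_r.
    rewrite <- (Rpower_O 6) by lra. apply Rle_Rpower; lra.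
  - rewrite wt1_neq; auto.
    assert (q <= 6 * IZR (enorm x)) as L.
    { unfold q. rewrite <- !plus_IZR, <- !mult_IZR. apply IZR_le, box_le_norm; auto. }
    pose proof (norm_ge_1 x Hx) as N1.
    rewrite !Rpower_Ropp.
    assert (Rpower q s <= Rpower 6 s * Rpower (IZR (enorm x)) s) as K.
    { rewrite Rpower_mult_distr by lra. apply Rle_Rpower_l; lra. }
    pose proof (Rpower_pos q s). pose proof (Rpower_pos (IZR (enorm x)) s).
    apply (Rmult_le_reg_r (Rpower q s)); auto.
    rewrite Rmult_assoc, Rinv_l, Rmult_1_r by lra.
    apply (Rmult_le_reg_l (Rpower (IZR (enorm x)) s)); auto.
    rewrite <- Rmult_assoc, Rinv_r, Rmult_1_l by lra. lra.
Qed.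

Lemma wt1_summable s : 1 < s -> exists K, forall l, NoDup l -> rsum (wt1 s) l <= K.
Proof.
  intros Hs. exists (Rpower 6 s * ((2 * (s / (s - 1))) * (2 * (s / (s - 1))))).
  intros l Nl. destruct (list_in_box l) as (n & Hn).
  eapply Rle_trans; [apply (rsum_incl _ _ _ (fun x => Rlt_le _ _ (wt1_pos s x)) Nl Hn)|].
  eapply Rle_trans; [apply rsum_le; intros x _; apply wt1_le_coord; lra|].
  rewrite rsum_scal.
  rewrite (rsum_list_prod (coord_wt s) (coord_wt s)).
  pose proof (coord_wt_bounded s n Hs).
  assert (0 <= rsum (coord_wt s) (zbox n)).
  { apply rsum_nonneg. intros; apply Rlt_le, Rpower_pos. }
  apply Rmult_le_compat_l; [apply Rlt_le, Rpower_pos|].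
  apply Rmult_le_compat; auto.
Qed.

Lemma wt_summable s : 1 < s -> exists K, forall l, NoDup l -> rsum (wt s) l <= K.
Proof.
  intros Hs. destruct (wt1_summable s Hs) as (K & HK). exists K; intros l Nl.
  eapply Rle_trans; [|apply (HK l Nl)]. apply rsum_le; intros; apply wt_le_wt1.
Qed.

Lemma heckef_has_sum m s : 1 < s -> exists L, has_sum (heckef m s) L.
Proof.
  intros Hs. destruct (wt_summable s Hs) as (K & HK).
  apply (has_sum_dominated _ (wt s) K); auto.
  intros x; rewrite Cmod_heckef; lra.
Qed.

(** * Boundedness of the L-functions near 1 *)

Lemma Cpow_lipschitz (a b : C) n :
  Cmod a <= 1 -> Cmod b <= 1 -> Cmod (a ^ n - b ^ n) <= INR n * Cmod (a - b).
Proof.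
  intros Ha Hb. induction n as [|n IH].
  - simpl. replace (1 - 1)%C with (RtoC 0) by ring. rewrite Cmod_0; lra.
  - rewrite S_INR, !Cpow_S.
    replace (a * a ^ n - b * b ^ n)%C with (a * (a ^ n - b ^ n) + b ^ n * (a - b))%C by ring.
    eapply Rle_trans; [apply Cmod_triangle|]. rewrite !Cmod_mult, Cmod_pow.
    assert (Cmod b ^ n <= 1).
    { rewrite <- (pow1 n). apply pow_incr; split; [apply Cmod_ge_0 | auto]. }
    pose proof (Cmod_ge_0 (a ^ n - b ^ n)). pose proof (Cmod_ge_0 (a - b)).
    pose proof (Cmod_ge_0 a). nra.
Qed.

Lemma Cmod_minus_sym (z w : C) : Cmod (z - w) = Cmod (w - z).
Proof. rewrite <- Cmod_opp. f_equal; ring. Qed.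

Lemma Cmod_le_add (z w : C) : Cmod z <= Cmod w + Cmod (w - z).
Proof.
  replace z with (w + - (w - z))%C at 1 by ring.
  eapply Rle_trans; [apply Cmod_triangle|]. rewrite Cmod_opp; lra.
Qed.

Lemma dir_lipschitz (z w : C) : 0 < Cmod z -> 0 < Cmod w ->
  Cmod (dir w - dir z) <= 2 * Cmod (w - z) / Cmod z.
Proof.
  intros Hz Hw. unfold dir.
  replace (w * RtoC (/ Cmod w) - z * RtoC (/ Cmod z))%C
    with ((w - z) * RtoC (/ Cmod z) + w * RtoC (/ Cmod w - / Cmod z))%C
    by (rewrite RtoC_minus; ring).
  eapply Rle_trans; [apply Cmod_triangle|]. rewrite !Cmod_mult, !Cmod_R.
  rewrite (Rabs_pos_eq (/ Cmod z)) by (left; apply Rinv_0_lt_compat; auto).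
  replace (/ Cmod w - / Cmod z) with ((Cmod z - Cmod w) * (/ Cmod w * / Cmod z)) by (field; lra).
  rewrite Rabs_mult, (Rabs_pos_eq (/ Cmod w * / Cmod z))
    by (apply Rmult_le_pos; left; apply Rinv_0_lt_compat; auto).
  assert (Rabs (Cmod z - Cmod w) <= Cmod (w - z)) as A.
  { pose proof (Cmod_le_add z w). pose proof (Cmod_le_add w z) as H0.
    rewrite (Cmod_minus_sym z w) in H0. apply Rabs_le; lra. }
  replace (Cmod w * (Rabs (Cmod z - Cmod w) * (/ Cmod w * / Cmod z)))
    with (Rabs (Cmod z - Cmod w) * / Cmod z) by (field; lra).
  pose proof (Rinv_0_lt_compat _ Hz). unfold Rdiv. nra.
Qed.

Lemma exp_le_exp x y : x <= y -> exp x <= exp y.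
Proof. intros [H|H]; [left; apply exp_increasing; auto | rewrite H; lra]. Qed.

(** By monotonicity in the exponent, [r^s] lies between 1 and [r^2]. This makes the later estimates
    uniform in [s]. *)
Lemma Rpower_sub_1 r s : 0 < r -> 0 <= s <= 2 -> Rabs (Rpower r s - 1) <= Rabs (r ^ 2 - 1).
Proof.
  intros Hr Hs.
  assert (r ^ 2 = exp (2 * ln r)) as ->.
  { rewrite <- (Rpower_pow 2 r Hr). unfold Rpower. auto. }
  unfold Rpower.
  destruct (Rle_dec 0 (ln r)) as [L|L].
  - pose proof (exp_le_exp 0 (s * ln r)). pose proof (exp_le_exp (s * ln r) (2 * ln r)).
    rewrite exp_0 in *. rewrite !Rabs_pos_eq; nra.
  - pose proof (exp_le_exp (s * ln r) 0). pose proof (exp_le_exp (2 * ln r) (s * ln r)).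
    rewrite exp_0 in *. rewrite !Rabs_left1; nra.
Qed.

Lemma Rpower_neg_diff x y s : 0 < x -> 0 < y -> 0 <= s <= 2 ->
  Rabs (Rpower y (- s) - Rpower x (- s)) <= Rpower x (- s) * Rabs ((x / y) ^ 2 - 1).
Proof.
  intros Hx Hy Hs.
  assert (0 < x / y) by (apply Rdiv_lt_0_compat; auto).
  assert (Rpower y (- s) = Rpower x (- s) * Rpower (x / y) s) as ->.
  { unfold Rpower. rewrite <- exp_plus, ln_div; auto. f_equal; ring. }
  replace (Rpower x (- s) * Rpower (x / y) s - Rpower x (- s))
    with (Rpower x (- s) * (Rpower (x / y) s - 1)) by ring.
  rewrite Rabs_mult, (Rabs_pos_eq (Rpower x (- s))) by (apply Rlt_le, Rpower_pos).
  apply Rmult_le_compat_l; [apply Rlt_le, Rpower_pos|]. apply Rpower_sub_1; auto.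
Qed.

(** With [r = a / b <= 2] the quantity is [r^4 - 1 = (r - 1)(r + 1)(r^2 + 1)]. The last two factors
    contribute at most 15 and [|r - 1| <= 2 d / a], whence 30. *)
Lemma radial_diff a b d : 0 < d -> 2 * d <= a -> Rabs (a - b) <= d ->
  Rabs ((a ^ 2 / b ^ 2) ^ 2 - 1) <= 30 * d / a.
Proof.
  intros Hd Ha Hab. apply Rabs_le_between in Hab.
  assert (0 < b) by lra.
  set (r := a / b).
  assert (0 < r <= 2) as Hr.
  { unfold r; split; [apply Rdiv_lt_0_compat; lra|].
    apply (Rmult_le_reg_r b); auto. unfold Rdiv; rewrite Rmult_assoc, Rinv_l; lra. }
  replace ((a ^ 2 / b ^ 2) ^ 2 - 1) with ((r - 1) * ((r + 1) * (r ^ 2 + 1)))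
    by (unfold r; field; lra).
  rewrite Rabs_mult.
  assert (0 <= (r + 1) * (r ^ 2 + 1) <= 15) as B by nra.
  rewrite (Rabs_pos_eq ((r + 1) * (r ^ 2 + 1))) by lra.
  assert (Rabs (r - 1) <= 2 * d / a) as R1.
  { replace (r - 1) with ((a - b) * / b) by (unfold r; field; lra).
    rewrite Rabs_mult, (Rabs_pos_eq (/ b)) by (left; apply Rinv_0_lt_compat; auto).
    replace (2 * d / a) with (d * (2 / a)) by (field; lra).
    apply Rmult_le_compat; [apply Rabs_pos | left; apply Rinv_0_lt_compat; auto | |].
    - apply Rabs_le; lra.
    - apply (Rmult_le_reg_r (a * b)); [nra|].
      replace (/ b * (a * b)) with a by (field; lra).
      replace (2 / a * (a * b)) with (2 * b) by (field; lra). lra. }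
  pose proof (Rabs_pos (r - 1)).
  replace (30 * d / a) with (2 * d / a * 15) by (field; lra).
  apply Rmult_le_compat; lra.
Qed.

(** The relative error is [O(d / |x|)]: the direction changes by at most [2 d / |x|] and is raised
    to the power [6 m], giving [12 m]; the weight gives 30 by [radial_diff]. *)
Lemma heckef_perturb m s d x y : 1 <= s <= 2 -> 0 < d -> x <> e0 -> y <> e0 ->
  2 * d <= Cmod (toC x) -> Cmod (toC y - toC x) <= d ->
  Cmod (heckef m s y - heckef m s x) <=
    (12 * INR m + 30) * d / Cmod (toC x) * wt s x.
Proof.
  intros Hs Hd Hx Hy Hz Hw.
  pose proof (Cmod_toC_pos x Hx) as Px. pose proof (Cmod_toC_pos y Hy) as Py.
  unfold heckef.
  replace (chi m y * RtoC (wt s y) - chi m x * RtoC (wt s x))%C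
    with ((chi m y - chi m x) * RtoC (wt s x) + chi m y * RtoC (wt s y - wt s x))%C
    by (rewrite RtoC_minus; ring).
  eapply Rle_trans; [apply Cmod_triangle|]. rewrite !Cmod_mult, !Cmod_R, Cmod_chi by auto.
  rewrite (Rabs_pos_eq (wt s x)) by apply wt_nonneg.
  assert (Cmod (chi m y - chi m x) <= 12 * INR m * d / Cmod (toC x)) as A1.
  { unfold chi. eapply Rle_trans.
    - apply Cpow_lipschitz; rewrite Cmod_dir; auto; lra.
    - rewrite mult_INR. pose proof (dir_lipschitz _ _ Px Py) as D.
      pose proof (pos_INR m). replace (INR 6) with 6 by (simpl; ring).
      apply Rle_trans with (6 * INR m * (2 * Cmod (toC y - toC x) / Cmod (toC x))).
      + apply Rmult_le_compat_l; lra.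
      + replace (12 * INR m * d / Cmod (toC x))
          with (6 * INR m * (2 * d / Cmod (toC x))) by (field; lra).
        apply Rmult_le_compat_l; [lra|].
        apply Rmult_le_compat_r; [left; apply Rinv_0_lt_compat; auto | lra]. }
  assert (Rabs (wt s y - wt s x) <= 30 * d / Cmod (toC x) * wt s x) as A2.
  { rewrite !wt_neq by auto.
    eapply Rle_trans; [apply Rpower_neg_diff|].
    - pose proof (norm_ge_1 x Hx); lra.
    - pose proof (norm_ge_1 y Hy); lra.
    - lra.
    - rewrite Rmult_comm. apply Rmult_le_compat_r; [apply Rlt_le, Rpower_pos|].
      rewrite <- !Cmod_toC_sqr. apply radial_diff; auto.
      pose proof (Cmod_le_add (toC x) (toC y)). pose proof (Cmod_le_add (toC y) (toC x)) as H0.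
      rewrite (Cmod_minus_sym (toC x)) in H0. apply Rabs_le; lra. }
  replace ((12 * INR m + 30) * d / Cmod (toC x) * wt s x)
    with (12 * INR m * d / Cmod (toC x) * wt s x + 30 * d / Cmod (toC x) * wt s x)
    by (field; lra).
  pose proof (wt_nonneg s x).
  apply Rplus_le_compat; [apply Rmult_le_compat_r; auto | lra].
Qed.

Lemma wt1_three_halves x : x <> e0 -> wt1 (3 / 2) x = / Cmod (toC x) ^ 3.
Proof.
  intros Hx. pose proof (Cmod_toC_pos x Hx) as P. rewrite wt1_neq, <- Cmod_toC_sqr; auto.
  rewrite Rpower_Ropp. f_equal.
  rewrite <- (Rpower_pow 2), <- (Rpower_pow 3), Rpower_mult by auto.
  f_equal. simpl; field.
Qed.

(** [wt1 (3 / 2)] is the summable [|x|^(-3)]. The three terms of the constant serve three cases: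
    [heckef_perturb] when [|b x| >= 2 d]; the trivial bound 2, at most [2 (2 d)^3 / |x|^3], when
    [|b x| < 2 d]; and the trivial bound at [x = 0]. *)
Lemma heckef_dilation_error m b d : b <> e0 -> 1 <= d ->
  exists K, forall s x j, 1 <= s <= 2 -> Cmod (toC j) <= d ->
    Cmod (heckef m s (eadd (emul b x) j) - heckef m s (emul b x)) <= K * wt1 (3 / 2) x.
Proof.
  intros Hb Hd. exists ((12 * INR m + 30) * d + 16 * d ^ 3 + 2).
  intros s x j Hs Hj.
  pose proof (pos_INR m) as M0.
  assert (d <= d ^ 3) as D3 by (simpl; nra).
  assert (Cmod (heckef m s (eadd (emul b x) j) - heckef m s (emul b x)) <= 2) as T.
  { unfold Cminus. eapply Rle_trans; [apply Cmod_triangle|]. rewrite Cmod_opp, !Cmod_heckef.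
    pose proof (wt_le_1 s (eadd (emul b x) j)). pose proof (wt_le_1 s (emul b x)). lra. }
  destruct (classic (x = e0)) as [->|Hx].
  { rewrite wt1_0. eapply Rle_trans; [apply T|]. nra. }
  assert (emul b x <> e0) as Hbx by (intros H; apply emul_eq_0 in H; tauto).
  pose proof (Cmod_toC_pos x Hx) as Px.
  assert (Cmod (toC x) <= Cmod (toC (emul b x))) as Le.
  { rewrite toC_mul, Cmod_mult. pose proof (Cmod_toC_ge_1 b Hb). nra. }
  rewrite wt1_three_halves by auto. set (a := Cmod (toC x)) in *.
  assert (0 < / a ^ 3) as I3 by (apply Rinv_0_lt_compat, pow_lt; auto).
  destruct (Rle_dec (2 * d) (Cmod (toC (emul b x)))) as [L|L].
  - assert (Cmod (toC (eadd (emul b x) j) - toC (emul b x)) <= d) as W.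
    { rewrite toC_add.
      replace (toC (emul b x) + toC j - toC (emul b x))%C with (toC j) by ring. auto. }
    assert (eadd (emul b x) j <> e0) as Hy.
    { intros E0. rewrite E0, toC_0 in W.
      replace (RtoC 0 - toC (emul b x))%C with (- toC (emul b x))%C in W by ring.
      rewrite Cmod_opp in W. lra. }
    eapply Rle_trans; [apply (heckef_perturb m s d); auto; lra|].
    set (z := Cmod (toC (emul b x))) in *.
    assert (wt s (emul b x) <= / z ^ 2) as W2.
    { eapply Rle_trans; [apply (wt_antitone 1); lra|].
      rewrite wt_neq by auto. rewrite <- Cmod_toC_sqr. fold z.
      rewrite Rpower_Ropp, Rpower_1; [lra|]. apply pow_lt; lra. }
    assert (/ z <= / a) as Iz by (apply Rinv_le_contravar; lra).
    assert (0 < / z) as I0 by (apply Rinv_0_lt_compat; lra).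
    assert (/ z * wt s (emul b x) <= / a ^ 3) as Q.
    { apply Rle_trans with (/ z * / z ^ 2); [apply Rmult_le_compat_l; lra|].
      rewrite <- Rinv_mult. apply Rinv_le_contravar; [apply pow_lt; auto|].
      replace (z * z ^ 2) with (z ^ 3) by ring. apply pow_incr; lra. }
    unfold Rdiv. rewrite Rmult_assoc.
    apply Rle_trans with ((12 * INR m + 30) * d * / a ^ 3).
    + apply Rmult_le_compat_l; [nra | auto].
    + apply Rmult_le_compat_r; [lra | nra].
  - eapply Rle_trans; [apply T|].
    apply Rle_trans with (16 * d ^ 3 * / a ^ 3).
    + apply (Rmult_le_reg_r (a ^ 3)); [apply pow_lt; auto|].
      rewrite Rmult_assoc, Rinv_l by (apply pow_nonzero; lra).
      assert (a ^ 3 <= (2 * d) ^ 3) by (apply pow_incr; lra).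
      replace ((2 * d) ^ 3) with (8 * d ^ 3) in H by ring. lra.
    + apply Rmult_le_compat_r; [lra | nra].
Qed.

(** The modulus [b = k + omega]. As [omega] is congruent to [-k], the rational integers
    [0, ..., N(b) - 1] represent all residues; and its argument is small but nonzero for large [k],
    which makes [chi m] nontrivial on it. *)
Definition kbeta (k : nat) : E := (Z.of_nat k, 1%Z).
Definition kres (k : nat) (j : nat) (x : E) : E := eadd (emul (kbeta k) x) (Z.of_nat j, 0%Z).

Lemma enorm_kbeta k : enorm (kbeta k) = Z.of_nat (k * k + k + 1).
Proof. unfold enorm, kbeta; cbn [fst snd]. lia. Qed.

Lemma kres_surj k y : exists j x, (j < k * k + k + 1)%nat /\ y = kres k j x.
Proof.
  destruct y as [a b]. set (n := Z.of_nat (k * k + k + 1)).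
  assert (0 < n)%Z by lia.
  pose proof (Z.div_mod (a - Z.of_nat k * b) n ltac:(lia)) as D.
  pose proof (Z.mod_pos_bound (a - Z.of_nat k * b) n ltac:(lia)) as M.
  set (q := ((a - Z.of_nat k * b) / n)%Z) in *. set (r := ((a - Z.of_nat k * b) mod n)%Z) in *.
  (* Subtracting [b] times [kbeta k] leaves the integer [a - k b = n q + r]. Since [n] is [kbeta k]
     times its conjugate, the quotient is [b + q conj(kbeta k)], where the conjugate is
     [(k + 1, -1)]. *)
  exists (Z.to_nat r), (b + (Z.of_nat k + 1) * q, - q)%Z. split; [lia|].
  unfold kres, kbeta, eadd, emul; cbn [fst snd]. rewrite Z2Nat.id by lia.
  f_equal; [|ring].
  assert (n = Z.of_nat k * Z.of_nat k + Z.of_nat k + 1)%Z as En by lia.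
  rewrite En in D. clearbody q r.
  replace a with ((a - Z.of_nat k * b) + Z.of_nat k * b)%Z by ring. rewrite D. ring.
Qed.

Lemma kres_inj k i j x y : (i < k * k + k + 1)%nat -> (j < k * k + k + 1)%nat ->
  kres k i x = kres k j y -> i = j /\ x = y.
Proof.
  intros Hi Hj. destruct x as [a b], y as [c d].
  unfold kres, kbeta, eadd, emul; cbn [fst snd]. intros H.
  pose proof (f_equal fst H) as H1. pose proof (f_equal snd H) as H2. cbn [fst snd] in H1, H2.
  assert (b = d)%Z as ->.
  { assert (c = a + (Z.of_nat k + 1) * (b - d))%Z as Ec by lia. rewrite Ec in H1.
    assert (Z.of_nat i - Z.of_nat j = (b - d) * Z.of_nat (k * k + k + 1))%Z as Eij.
    { replace (Z.of_nat (k * k + k + 1)) with (Z.of_nat k * Z.of_nat k + Z.of_nat k + 1)%Z by lia.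
      lia. }
    nia. }
  assert (a = c)%Z as -> by lia. split; [lia | auto].
Qed.

(** Each residue class sums to [heckef m s (kbeta k) * L] up to an error independent of [s], and the
    number of classes is the norm of [kbeta k]. *)
Lemma heckef_dilation m k :
  exists K, forall s L, 1 < s <= 2 -> has_sum (heckef m s) L ->
    Cmod (L - RtoC (INR (k * k + k + 1)) * (heckef m s (kbeta k) * L)) <= K.
Proof.
  set (n := (k * k + k + 1)%nat).
  assert (kbeta k <> e0) as Hb by (intros H; discriminate).
  destruct (heckef_dilation_error m (kbeta k) (INR n)) as (K & HK); auto.
  { unfold n. rewrite plus_INR. pose proof (pos_INR (k * k + k)). simpl; lra. }
  destruct (wt1_summable (3 / 2)) as (W & HW); [lra|].
  exists (INR n * (K * W)). intros s L Hs HL.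
  assert (K0 : 0 <= K).
  { pose proof (HK 2 e0 e0 ltac:(lra)) as H. rewrite toC_0, Cmod_0, wt1_0 in H.
    specialize (H (pos_INR n)). eapply Rle_trans; [apply Cmod_ge_0|]. rewrite Rmult_1_r in H; apply H. }
  (* The term [heckef m s] cut off to the class of [j], so that all class sums range over the same
     index type and can be added. *)
  pose (g := fun j y => if excluded_middle_informative (exists x, y = kres k j x)
    then heckef m s y else RtoC 0).
  destruct (has_sum_csum_near g (heckef m s (kbeta k) * L)%C (K * W) (seq 0 n)) as (S & HS & BS).
  - intros j Hj. apply in_seq in Hj.
    assert (inj : forall x y, kres k j x = kres k j y -> x = y).
    { intros x y E0. apply kres_inj in E0; try tauto; lia. }
    destruct (wt_summable s ltac:(lra)) as (V & HV).
    destruct (has_sum_dominated (fun x => heckef m s (kres k j x))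
      (fun x => wt s (kres k j x)) V) as (M & HM).
    { intros x; rewrite Cmod_heckef; lra. }
    { intros l Nl. rewrite <- (rsum_map (wt s) (kres k j)). apply HV.
      apply FinFun.Injective_map_NoDup; auto. }
    exists M; split.
    + apply (has_sum_push (kres k j)); auto.
      * intros u Hu. unfold g. destruct excluded_middle_informative as [(x & Hx)|]; auto.
        exfalso; eapply Hu; eauto.
      * eapply has_sum_ext; [|apply HM]. intros x; simpl. unfold g.
        destruct excluded_middle_informative as [|N]; auto. exfalso; eauto.
    + apply (has_sum_bound (fun x => heckef m s (kres k j x) - heckef m s (kbeta k) * heckef m s x)%C
        _ (fun x => K * wt1 (3 / 2) x)).
      * apply has_sum_minus; auto. apply has_sum_scal; auto.
      * intros x. rewrite <- heckef_mul. apply HK; [lra|].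
        replace (toC (Z.of_nat j, 0%Z)) with (RtoC (INR j)).
        -- rewrite Cmod_R, Rabs_pos_eq by apply pos_INR. apply le_INR; lia.
        -- rewrite toC_pair, INR_IZR_INZ. unfold RtoC; simpl; f_equal; field.
      * intros l Nl. rewrite rsum_scal. apply Rmult_le_compat_l; auto.
  (* The classes partition the lattice: exactly one [g j] is alive at each [y], so the total [S] is
     [L]. *)
  - replace L with S at 1; [rewrite length_seq in BS; apply BS|].
    apply (has_sum_unique (heckef m s)); auto.
    eapply has_sum_ext; [|apply HS]. intros y; simpl.
    destruct (kres_surj k y) as (j & x & Hj & ->).
    rewrite (csum_single _ _ j).
    + unfold g. destruct excluded_middle_informative as [|N]; auto. exfalso; eauto.
    + apply seq_NoDup.
    + apply in_seq; unfold n; lia.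
    + intros i Hi Hne. apply in_seq in Hi. unfold g.
      destruct excluded_middle_informative as [(z & Hz)|]; auto.
      apply kres_inj in Hz; [|lia|unfold n in Hi; lia]. exfalso; apply Hne; symmetry; tauto.
Qed.

(** * Polar form and nontrivial values of the characters *)

Lemma cis_add a b : cis (a + b) = (cis a * cis b)%C.
Proof. unfold cis, Cmult; simpl. rewrite cos_plus, sin_plus. f_equal; ring. Qed.

Lemma cis_0 : cis 0 = RtoC 1.
Proof. unfold cis, RtoC. rewrite cos_0, sin_0. auto. Qed.

Lemma cis_pow t n : (cis t ^ n)%C = cis (INR n * t).
Proof.
  induction n as [|n IH].
  - simpl. rewrite Rmult_0_l, cis_0. auto.
  - rewrite Cpow_S, IH, <- cis_add. f_equal. rewrite S_INR. ring.
Qed.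

Lemma Cmod_cis t : Cmod (cis t) = 1.
Proof.
  unfold Cmod, cis; simpl.
  replace (cos t * (cos t * 1) + sin t * (sin t * 1)) with 1; [apply sqrt_1|].
  pose proof (sin2_cos2 t) as H. unfold Rsqr in H. lra.
Qed.

Lemma polar (z : C) : 0 < Cmod z -> exists t, z = (RtoC (Cmod z) * cis t)%C.
Proof.
  intros Hz. pose proof (Cmod2_alt z) as M2. destruct z as [x y].
  unfold Re, Im in M2; cbn [fst snd] in M2.
  set (r := Cmod (x, y)) in *.
  assert (-1 <= x / r <= 1) as B.
  { split; apply (Rmult_le_reg_r r); auto; unfold Rdiv; rewrite Rmult_assoc, Rinv_l; nra. }
  assert (r * sqrt (1 - (x / r)²) = Rabs y) as S.
  { rewrite <- (sqrt_Rsqr r) at 1 by lra.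
    rewrite <- sqrt_mult, <- sqrt_Rsqr_abs.
    - f_equal. unfold Rsqr. replace (r * r * (1 - x / r * (x / r))) with (r ^ 2 - x ^ 2) by (field; lra).
      rewrite M2; ring.
    - apply Rle_0_sqr.
    - unfold Rsqr. nra. }
  destruct (Rle_dec 0 y) as [Y|Y].
  - exists (acos (x / r)). unfold cis, Cmult, RtoC; simpl.
    rewrite cos_acos, sin_acos, S, Rabs_pos_eq by auto. f_equal; field; lra.
  - exists (- acos (x / r)). unfold cis, Cmult, RtoC; simpl.
    rewrite cos_neg, sin_neg, cos_acos, sin_acos by auto.
    rewrite Rabs_left in S by lra.
    f_equal; [field; lra|].
    replace (r * - sqrt (1 - (x / r)²)) with (- (r * sqrt (1 - (x / r)²))) by ring. rewrite S; ring.
Qed.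

Lemma dir_polar r t : 0 < r -> dir (RtoC r * cis t) = cis t.
Proof.
  intros Hr. unfold dir. rewrite Cmod_mult, Cmod_R, Cmod_cis, Rmult_1_r, Rabs_pos_eq by lra.
  replace (RtoC r * cis t * RtoC (/ r))%C with (RtoC (r * / r) * cis t)%C
    by (rewrite RtoC_mult; ring).
  rewrite Rinv_r by lra. ring.
Qed.

Lemma chi_polar m x r t : 0 < r -> toC x = (RtoC r * cis t)%C ->
  chi m x = cis (INR m * (6 * t)).
Proof.
  intros Hr Hx. unfold chi. rewrite Hx, dir_polar, cis_pow by auto.
  f_equal. rewrite mult_INR. simpl; ring.
Qed.

Lemma atan_le_id u : 0 < u -> atan u <= u.
Proof.
  intros Hu.
  destruct (MVT_cor2 atan (fun x => / (1 + x ^ 2)) 0 u Hu) as (c & Hc & Hc').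
  { intros c _. apply derivable_pt_lim_atan. }
  rewrite atan_0 in Hc.
  assert (/ (1 + c ^ 2) <= / 1) by (apply Rinv_le_contravar; nra).
  rewrite Rinv_1 in H. nra.
Qed.

Lemma chi_nontrivial m : (1 <= m)%nat -> exists k, Re (chi m (kbeta k)) < 1.
Proof.
  (* The argument of [k + omega] is [atan u] with [u = (sqrt 3 / 2) / (k + 1 / 2) < 1 / k]. With
     [k = 6 m] the angle [6 m atan u] lies in [(0, 1]], where the cosine is below 1. *)
  intros Hm. exists (6 * m)%nat. set (k := (6 * m)%nat).
  set (x := INR k + 1 / 2). set (y := sqrt 3 / 2).
  assert (INR k = 6 * INR m) as Ek by (unfold k; rewrite mult_INR; simpl; ring).
  assert (1 <= INR m) as M1 by (apply (le_INR 1); auto).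
  assert (0 < x) by (unfold x; lra).
  pose proof sqrt3_sqr as S3. pose proof (sqrt_pos 3).
  assert (0 < y < 1) as Hy by (unfold y; split; nra).
  set (u := y / x). assert (0 < u) by (apply Rdiv_lt_0_compat; lra).
  assert (toC (kbeta k) = (RtoC (x * sqrt (1 + u²)) * cis (atan u))%C) as P.
  { rewrite toC_pair. unfold kbeta; cbn [fst snd]. rewrite <- INR_IZR_INZ.
    unfold cis. rewrite cos_atan, sin_atan.
    assert (0 < sqrt (1 + u²)) by (apply sqrt_lt_R0; pose proof (Rle_0_sqr u); lra).
    assert (x * u = y) as XU by (unfold u; field; lra).
    set (h := sqrt (1 + u²)) in *. clearbody h u.
    unfold Cmult, RtoC; cbn [fst snd]. f_equal.
    - replace (x * h * (1 / h) - 0 * (u / h)) with x by (field; lra). unfold x; ring.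
    - replace (x * h * (u / h) + 0 * (1 / h)) with (x * u) by (field; lra).
      rewrite XU; unfold y; ring. }
  rewrite (chi_polar m _ (x * sqrt (1 + u²)) (atan u)); auto.
  2:{ apply Rmult_lt_0_compat; auto. apply sqrt_lt_R0; pose proof (Rle_0_sqr u); lra. }
  unfold cis, Re; simpl.
  pose proof (atan_le_id u ltac:(auto)) as A.
  assert (0 < atan u) by (rewrite <- atan_0; apply atan_increasing; auto).
  assert (u * (6 * INR m) <= 1).
  { unfold u. apply (Rmult_le_reg_r x); auto.
    replace (y / x * (6 * INR m) * x) with (y * (6 * INR m)) by (field; lra).
    unfold x. nra. }
  pose proof PI2_1.
  rewrite <- cos_0. apply cos_decreasing_1; nra.
Qed.

(** The square is [(1 - r)^2 + 2 r (1 - Re u)]: the first term gives 1/4 for [r <= 1/2], the second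
    gives [1 - Re u] otherwise. The bound is free of [r], hence uniform as [s] tends to 1. *)
Lemma Cmod_1_minus_lower (u : C) r : Cmod u = 1 -> 0 < r <= 1 ->
  Rmin (1 / 4) (1 - Re u) <= Cmod (1 - RtoC r * u) ^ 2.
Proof.
  intros Hu Hr. pose proof (Cmod2_alt u) as M. rewrite Hu in M.
  rewrite Cmod2_alt. destruct u as [a b]; simpl in *.
  pose proof (Rmin_l (1 / 4) (1 - a)). pose proof (Rmin_r (1 / 4) (1 - a)).
  replace ((1 + - (r * a - 0 * b)) * ((1 + - (r * a - 0 * b)) * 1) +
    (0 + - (r * b + 0 * a)) * ((0 + - (r * b + 0 * a)) * 1))
    with (1 - 2 * r * a + r * r * (a * (a * 1) + b * (b * 1))) by ring.
  rewrite <- M. destruct (Rle_dec r (1 / 2)); [nra|].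
  assert (a <= 1) by nra. nra.
Qed.

Lemma lfun_bounded m : (1 <= m)%nat ->
  exists K, forall s L, 1 < s <= 2 -> has_sum (heckef m s) L -> Cmod L <= K.
Proof.
  intros Hm. destruct (chi_nontrivial m Hm) as (k & Hk).
  destruct (heckef_dilation m k) as (K & HK).
  set (c := Rmin (1 / 4) (1 - Re (chi m (kbeta k)))).
  assert (0 < c) as Hc by (apply Rmin_glb_lt; lra).
  exists (2 * K / c). intros s L Hs HL. specialize (HK s L Hs HL).
  assert (kbeta k <> e0) as Hb by (intros H; discriminate).
  set (n := INR (k * k + k + 1)) in *.
  assert (1 <= n) as N1.
  { unfold n. rewrite plus_INR. pose proof (pos_INR (k * k + k)). simpl; lra. }
  (* [r = N(b)^(1 - s)], so [heckef_dilation] bounds [|L| |1 - r chi(b)|]. The second factor [q]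
     satisfies [c <= q^2 <= 2 q], whence the bound [2 K / c]. *)
  set (r := n * Rpower n (- s)).
  assert (0 < r <= 1) as Hr.
  { unfold r. split; [apply Rmult_lt_0_compat; [lra | apply Rpower_pos]|].
    rewrite <- (Rpower_1 n) at 1 by lra. rewrite <- Rpower_plus. apply Rpower_le_1; lra. }
  pose proof (Cmod_1_minus_lower (chi m (kbeta k)) r (Cmod_chi m _ Hb) Hr) as Lo. fold c in Lo.
  replace (L - RtoC n * (heckef m s (kbeta k) * L))%C
    with (L * (1 - RtoC r * chi m (kbeta k)))%C in HK.
  2:{ unfold heckef. rewrite wt_neq, enorm_kbeta, <- INR_IZR_INZ by auto. fold n.
      unfold r. rewrite RtoC_mult. ring. }
  rewrite Cmod_mult in HK.
  set (q := Cmod (1 - RtoC r * chi m (kbeta k))) in *.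
  assert (q <= 2) as Q2.
  { unfold q, Cminus. eapply Rle_trans; [apply Cmod_triangle|].
    rewrite Cmod_opp, Cmod_mult, !Cmod_R, Cmod_chi, !Rabs_pos_eq by (auto; lra). lra. }
  pose proof (Cmod_ge_0 (1 - RtoC r * chi m (kbeta k))) as Q0. fold q in Q0.
  pose proof (Cmod_ge_0 L).
  apply (Rmult_le_reg_r c); auto. unfold Rdiv. rewrite Rmult_assoc, Rinv_l, Rmult_1_r by lra.
  assert (c <= 2 * q) by nra. nra.
Qed.

(** * Divergence at 1 *)

(** Row [n] has [n] points of norm at most [3 n^2], so it contributes at least [1 / (3 n)]: a third
    of the harmonic series. *)
Fixpoint triangle (n : nat) : list E :=
  match n with
  | O => nil
  | S n' => map (fun i => (Z.of_nat n, Z.of_nat i)) (seq 0 n) ++ triangle n'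
  end.

Lemma triangle_fst n x : In x (triangle n) -> (0 < fst x <= Z.of_nat n)%Z.
Proof.
  induction n as [|n IH]; [simpl; tauto|]. simpl triangle. intros H.
  apply (in_app_or (map (fun i => (Z.of_nat (S n), Z.of_nat i)) (seq 0 (S n)))) in H as [H|H].
  - apply in_map_iff in H as (i & <- & _). cbn [fst]. lia.
  - apply IH in H. lia.
Qed.

Lemma triangle_NoDup n : NoDup (triangle n).
Proof.
  induction n as [|n IH]; [constructor|].
  change (triangle (S n))
    with (map (fun i => (Z.of_nat (S n), Z.of_nat i)) (seq 0 (S n)) ++ triangle n).
  apply NoDup_app; auto.
  - apply FinFun.Injective_map_NoDup; [|apply seq_NoDup].
    intros i j H. injection H; lia.
  - intros x H H'. apply in_map_iff in H as (i & <- & _).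
    apply triangle_fst in H'. cbn [fst] in H'. lia.
Qed.

Lemma wt_inv x : x <> e0 -> wt 1 x = / IZR (enorm x).
Proof.
  intros H. rewrite wt_neq, Rpower_Ropp, Rpower_1; auto. pose proof (norm_ge_1 x H); lra.
Qed.

Lemma triangle_sum n : ln (1 + INR n) / 3 <= rsum (wt 1) (triangle n).
Proof.
  induction n as [|n IH]; [simpl; rewrite Rplus_0_r, ln_1; lra|].
  change (triangle (S n))
    with (map (fun i => (Z.of_nat (S n), Z.of_nat i)) (seq 0 (S n)) ++ triangle n).
  rewrite rsum_app, rsum_map. pose proof (pos_INR n) as P. set (N := INR (S n)).
  assert (1 <= N) as N1 by (unfold N; rewrite S_INR; lra).
  assert (N * / (3 * N ^ 2) <=
    rsum (fun i => wt 1 (Z.of_nat (S n), Z.of_nat i)) (seq 0 (S n))) as Row.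
  { replace (N * / (3 * N ^ 2)) with (rsum (fun _ : nat => / (3 * N ^ 2)) (seq 0 (S n)))
      by (rewrite rsum_const, length_seq; auto).
    apply rsum_le. intros i Hi. apply in_seq in Hi.
    assert ((Z.of_nat (S n), Z.of_nat i) <> e0) as H0 by (intros H; injection H; lia).
    rewrite wt_inv by auto. pose proof (norm_ge_1 _ H0).
    apply Rinv_le_contravar; [lra|].
    replace (3 * N ^ 2) with (3 * (N * N)) by ring.
    unfold N. rewrite INR_IZR_INZ, <- !mult_IZR. apply IZR_le.
    unfold enorm; cbn [fst snd]. nia. }
  replace (N * / (3 * N ^ 2)) with (/ N / 3) in Row by (field; lra).
  assert (ln (1 + N) - ln N <= / N).
  { pose proof (ln_le_sub_1 ((1 + N) / N)) as L.
    rewrite ln_div in L by lra.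
    replace ((1 + N) / N - 1) with (/ N) in L by (field; lra).
    apply L, Rdiv_lt_0_compat; lra. }
  replace (1 + INR n) with N in IH by (unfold N; rewrite S_INR; ring). lra.
Qed.

Lemma wt_1_diverges K : exists l, NoDup l /\ K <= rsum (wt 1) l.
Proof.
  destruct (INR_unbounded (exp (3 * K))) as (n & Hn).
  exists (triangle n); split; [apply triangle_NoDup|].
  eapply Rle_trans; [|apply triangle_sum].
  assert (3 * K <= ln (1 + INR n)); [|lra].
  rewrite <- (ln_exp (3 * K)). apply Rlt_le, ln_increasing; [apply exp_pos | lra].
Qed.

Lemma heckef_trivial s x : heckef 0 s x = RtoC (wt s x).
Proof. unfold heckef, chi. simpl. ring. Qed.

Lemma zeta_unbounded K :
  exists s, 1 < s <= 2 /\ forall L, has_sum (heckef 0 s) L -> K <= Cmod L.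
Proof.
  destruct (wt_1_diverges (3 * Rabs K)) as (l & Nl & Hl).
  assert (exists X, 1 <= X /\ forall x, In x l -> IZR (enorm x) <= X) as (X & X1 & HX).
  { clear. induction l as [|x l (X & X1 & HX)]; [exists 1; split; [lra|simpl; tauto]|].
    exists (X + IZR (enorm x)). pose proof (IZR_le _ _ (norm_nonneg x)).
    split; [lra|]. intros y [<-|Hy]; [lra|]. specialize (HX y Hy); lra. }
  assert (0 <= ln X) as LX by (rewrite <- ln_1; destruct X1 as [X1|<-]; [left; apply ln_increasing; lra|lra]).
  (* Makes [N^d <= exp 1 <= 3] for every norm [N <= X], so passing from exponent 1 to [1 + d] loses
     at most the factor 3 put into [3 * Rabs K]. *)
  set (d := / (1 + ln X)).
  assert (0 < d <= 1) as Hd.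
  { unfold d; split; [apply Rinv_0_lt_compat; lra|]. rewrite <- Rinv_1. apply Rinv_le_contravar; lra. }
  assert (d * ln X <= 1) as DL.
  { unfold d. apply (Rmult_le_reg_l (1 + ln X)); [lra|].
    rewrite <- Rmult_assoc, Rinv_r; lra. }
  exists (1 + d); split; [lra|]. intros L HL.
  destruct (wt_summable (1 + d)) as (W & HW); [lra|].
  destruct (has_sum_nonneg (wt (1 + d)) W (wt_nonneg _) HW) as (z & Hz & Bz).
  assert (L = RtoC z) as ->.
  { eapply has_sum_unique; [apply HL|]. eapply has_sum_ext; [|apply Hz].
    intros x; simpl; rewrite heckef_trivial; auto. }
  rewrite Cmod_R. specialize (Bz l Nl).
  assert (rsum (wt 1) l <= 3 * rsum (wt (1 + d)) l) as C3.
  { rewrite <- rsum_scal. apply rsum_le. intros x Hx.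
    destruct (classic (x = e0)) as [->|H0]; [rewrite !wt_0; lra|].
    rewrite !wt_neq by auto. pose proof (norm_ge_1 x H0) as N1. specialize (HX x Hx).
    set (N := IZR (enorm x)) in *.
    replace (- (1 + d)) with (- (1) + - d) by ring. rewrite Rpower_plus.
    assert (1 <= 3 * Rpower N (- d)).
    { rewrite Rpower_Ropp. apply (Rmult_le_reg_r (Rpower N d)); [apply Rpower_pos|].
      rewrite Rmult_assoc, Rinv_l by (apply Rgt_not_eq, Rpower_pos).
      apply Rle_trans with (exp 1); [|pose proof exp_le_3; lra].
      rewrite Rmult_1_l. unfold Rpower. apply exp_le_exp.
      apply Rle_trans with (d * ln X); auto.
      apply Rmult_le_compat_l; [lra|]. destruct HX as [HX| ->]; [left; apply ln_increasing; lra|lra]. }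
    pose proof (Rpower_pos N (- (1))). nra. }
  pose proof (Rle_abs K). pose proof (Rle_abs z). lra.
Qed.

(** * Sieving by finitely many primes *)

Fixpoint sieved (m : nat) (s : R) (P : list E) (x : E) : C :=
  match P with
  | nil => heckef m s x
  | p :: P' => if excluded_middle_informative (edvd p x) then RtoC 0 else sieved m s P' x
  end.

(** The reciprocal of the usual partial Euler product. *)
Definition euler (m : nat) (s : R) (P : list E) : C :=
  fold_right (fun p z => ((1 - heckef m s p) * z)%C) (RtoC 1) P.

Lemma sieved_mul m s P p x : prime_list P -> (forall q, In q P -> ~ edvd q p) ->
  sieved m s P (emul p x) = (heckef m s p * sieved m s P x)%C.
Proof.
  induction 1 as [|q P Hq Hn HP IH]; intros Hd; simpl; [apply heckef_mul|].
  destruct (excluded_middle_informative (edvd q (emul p x))) as [D|D];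
    destruct (excluded_middle_informative (edvd q x)) as [D'|D'].
  - ring.
  - exfalso. destruct Hq as (_ & _ & Pq). destruct (Pq p x D) as [K|K]; auto.
    apply (Hd q); auto. left; auto.
  - exfalso. apply D. destruct D' as (z & ->). exists (emul p z). ring.
  - apply IH. intros r Hr. apply Hd; right; auto.
Qed.

(** Sieving by one more prime [p] removes the sum over the multiples [p x], which by [sieved_mul] is
    [heckef m s p] times the sum before removal. *)
Lemma sieved_has_sum m s P L : prime_list P -> has_sum (heckef m s) L ->
  has_sum (sieved m s P) (L * euler m s P)%C.
Proof.
  intros HP HL. induction HP as [|p P Hp Hn HP IH]; simpl.
  - replace (L * RtoC 1)%C with L by ring. auto.
  - replace (L * ((1 - heckef m s p) * euler m s P))%C
      with (L * euler m s P - heckef m s p * (L * euler m s P))%C by ring.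
    pose (g := fun x => if excluded_middle_informative (edvd p x)
      then sieved m s P x else RtoC 0).
    apply (has_sum_ext (fun x => sieved m s P x - g x)%C).
    { intros x. unfold g. destruct excluded_middle_informative; ring. }
    apply has_sum_minus; auto. apply (has_sum_push (emul p)).
    + intros x y. apply emul_cancel_l. apply Hp.
    + intros u Hu. unfold g. destruct excluded_middle_informative as [(z & Hz)|]; auto.
      exfalso; eapply Hu; eauto.
    + eapply has_sum_ext; [|apply (has_sum_scal (heckef m s p) _ _ IH)].
      intros x; simpl. unfold g. destruct excluded_middle_informative as [|N].
      * rewrite sieved_mul; auto.
      * exfalso; apply N. exists x; auto.
Qed.

Lemma Cmod_sieved_le m s P x : Cmod (sieved m s P x) <= wt s x.
Proof.
  induction P as [|p P IH]; simpl; [rewrite Cmod_heckef; lra|].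
  destruct excluded_middle_informative; auto. rewrite Cmod_0. apply wt_nonneg.
Qed.

Lemma sieved_dvd m s P p x : In p P -> edvd p x -> sieved m s P x = RtoC 0.
Proof.
  induction P as [|q P IH]; simpl; [tauto|]. intros [->|Hp] D;
    destruct excluded_middle_informative; auto; tauto.
Qed.

Lemma sieved_0 m s P : sieved m s P e0 = RtoC 0.
Proof.
  induction P as [|q P IH]; simpl; [apply heckef_0|]. destruct excluded_middle_informative; auto.
Qed.

Lemma sieved_unit m s P u : prime_list P -> enorm u = 1%Z -> sieved m s P u = RtoC 1.
Proof.
  intros HP Hu. induction HP as [|p P Hp Hn HP IH]; simpl; [apply heckef_unit; auto|].
  destruct excluded_middle_informative as [(z & ->)|]; auto.
  exfalso. destruct Hp as (P0 & P1 & _). rewrite norm_mul in Hu.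
  pose proof (norm_pos p P0). apply P1. apply Z.mul_eq_1 in Hu. lia.
Qed.

Lemma eunits_NoDup : NoDup eunits.
Proof. unfold eunits. repeat constructor; simpl; intuition discriminate. Qed.

(** [l0] carries all but 1 of the total weight, and [P] kills every nonunit in it; the six units
    contribute 1 each. The same [P] serves all [m], since [wt] dominates every character. *)
Lemma sieve_near_6 s : 1 < s ->
  exists P, prime_list P /\
    forall m L, has_sum (heckef m s) L -> Cmod (L * euler m s P - RtoC 6) <= 1.
Proof.
  intros Hs. destruct (wt_summable s Hs) as (K & HK).
  destruct (nonneg_tail (wt s) K 1 (wt_nonneg s) HK ltac:(lra)) as (l0 & N0 & T0).
  destruct (prime_list_cover l0) as (P & HP & CP). exists P; split; auto.
  intros m L HL. pose proof (sieved_has_sum m s P L HP HL) as HS.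
  destruct (incl_NoDup_hull (l0 ++ eunits)) as (l1 & N1 & I1).
  destruct (NoDup_incl_split eunits l1) as (l2 & P2 & N2 & D2); auto.
  { apply eunits_NoDup. }
  { intros x Hx; apply I1, in_or_app; auto. }
  assert (csum (sieved m s P) l1 = RtoC 6) as <-.
  { rewrite (csum_perm _ _ _ P2), csum_app, (csum_0 _ l2).
    - rewrite (csum_ext _ (fun _ => RtoC 1)).
      + unfold eunits, csum; simpl. rewrite <- !RtoC_plus. f_equal; ring.
      + intros u Hu. apply sieved_unit; auto. apply norm_1_units; auto.
    - intros x Hx. destruct (classic (x = e0)) as [->|X0]; [apply sieved_0|].
      assert (In x l0) as X1.
      { assert (In x (l0 ++ eunits)) as H.
        { apply I1. eapply Permutation_in; [symmetry; apply P2|]. apply in_or_app; auto. }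
        apply in_app_or in H as [H|H]; auto. exfalso; eapply D2; eauto. }
      destruct (CP x X1 X0) as (p & Hp & Dp).
      { intros H. apply norm_1_units in H. eapply D2; eauto. }
      eapply sieved_dvd; eauto. }
  apply has_sum_tail; auto. intros l Nl Dl.
  eapply Rle_trans; [apply Cmod_csum_le|].
  apply Rle_trans with (rsum (wt s) l).
  - apply rsum_le; intros x _; apply Cmod_sieved_le.
  - apply T0; auto. intros x Hx Hx0. apply (Dl x Hx), I1, in_or_app; auto.
Qed.

(** Replaces the complex logarithm of an Euler factor: [1 + x <= exp x] applied to the expanded
    square. *)
Lemma Cmod_1_minus_sqr_le (z : C) : Cmod (1 - z) ^ 2 <= exp (- 2 * Re z + Cmod z ^ 2).
Proof.
  eapply Rle_trans; [|apply exp_ineq1_le]. rewrite !Cmod2_alt.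
  destruct z as [a b]; simpl. right; ring.
Qed.

Lemma Cmod_euler_sqr_le m s P :
  Cmod (euler m s P) ^ 2 <=
    exp (- 2 * rsum (fun p => Re (chi m p) * wt s p) P + rsum (fun p => wt s p ^ 2) P).
Proof.
  induction P as [|p P IH]; simpl.
  - rewrite Cmod_1. replace (-2 * 0 + 0) with 0 by ring. rewrite exp_0; lra.
  - rewrite Cmod_mult.
    pose proof (Cmod_1_minus_sqr_le (heckef m s p)) as H1.
    rewrite Re_heckef, Cmod_heckef in H1.
    replace (-2 * (Re (chi m p) * wt s p + rsum (fun q => Re (chi m q) * wt s q) P) +
      (wt s p * (wt s p * 1) + rsum (fun q => wt s q * (wt s q * 1)) P))
      with ((-2 * (Re (chi m p) * wt s p) + wt s p ^ 2) +
        (-2 * rsum (fun q => Re (chi m q) * wt s q) P + rsum (fun q => wt s q ^ 2) P))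
      by (simpl; ring).
    rewrite exp_plus.
    replace (Cmod (1 - heckef m s p) * Cmod (euler m s P) *
      (Cmod (1 - heckef m s p) * Cmod (euler m s P) * 1))
      with (Cmod (1 - heckef m s p) ^ 2 * Cmod (euler m s P) ^ 2) by ring.
    apply Rmult_le_compat; auto; apply pow2_ge_0.
Qed.

Lemma wt_le_half s p : 1 <= s -> eprime p -> wt s p <= 1 / 2.
Proof.
  intros Hs (P0 & P1 & _). eapply Rle_trans; [apply (wt_antitone 1); auto|].
  rewrite wt_inv by auto. unfold Rdiv. rewrite Rmult_1_l. apply Rinv_le_contravar; [lra|].
  apply IZR_le. pose proof (norm_pos p P0). lia.
Qed.

Lemma Cmod_euler_trivial_ge s P : 1 <= s -> prime_list P ->
  exp (- (2 * rsum (wt s) P)) <= Cmod (euler 0 s P).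
Proof.
  intros Hs HP. induction HP as [|p P Hp Hn HP IH]; simpl.
  - rewrite Cmod_1, Rmult_0_r, Ropp_0, exp_0. lra.
  - rewrite Cmod_mult, heckef_trivial, <- RtoC_minus, Cmod_R.
    pose proof (wt_le_half s p Hs Hp) as H1. pose proof (wt_nonneg s p).
    rewrite Rabs_pos_eq by lra.
    replace (- (2 * (wt s p + rsum (wt s) P)))
      with (- (2 * wt s p) + - (2 * rsum (wt s) P)) by ring.
    rewrite exp_plus. apply Rmult_le_compat; auto; try (left; apply exp_pos).
    (* For [0 <= w <= 1/2] one has [(1 - w)(1 + 2 w) >= 1], hence [1 - w >= exp(-2 w)]. *)
    rewrite exp_Ropp. pose proof (exp_ineq1_le (2 * wt s p)) as H2.
    apply (Rmult_le_reg_r (exp (2 * wt s p))); [apply exp_pos|].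
    rewrite Rinv_l by (apply Rgt_not_eq, exp_pos). nra.
Qed.

Lemma wt_sqr_le s p : 1 <= s -> wt s p ^ 2 <= wt1 2 p.
Proof.
  intros Hs. destruct (classic (p = e0)) as [->|P0].
  { rewrite wt_0, wt1_0. simpl; lra. }
  pose proof (wt_antitone 1 s p Hs). pose proof (wt_nonneg s p).
  apply Rle_trans with (wt 1 p * wt 1 p); [simpl; nra|].
  rewrite wt_neq, wt1_neq, <- Rpower_plus by auto. right; f_equal; ring.
Qed.

(* From the Euler product, [exp (2 S)] is at most a constant times [|L| ^ 2],
   where [S] is the character sum over the sieving primes. *)
Lemma prime_sum_upper m : (1 <= m)%nat ->
  exists K, forall s P, 1 < s <= 2 -> prime_list P ->
    (forall L, has_sum (heckef m s) L -> Cmod (L * euler m s P - RtoC 6) <= 1) ->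
    rsum (fun p => Re (chi m p) * wt s p) P <= K.
Proof.
  intros Hm. destruct (lfun_bounded m Hm) as (K & HK).
  destruct (wt1_summable 2) as (W & HW); [lra|].
  (* From [25 exp(2 S) <= K^2 exp W], with [5 = 6 - 1] squared, and the crude [S <= 25 exp(2 S)]. *)
  exists (K ^ 2 * exp W). intros s P Hs HP H6.
  destruct (heckef_has_sum m s) as (L & HL); [lra|]. specialize (H6 L HL).
  assert (5 <= Cmod L * Cmod (euler m s P)) as H5.
  { rewrite <- Cmod_mult. pose proof (Cmod_le_add (RtoC 6) (L * euler m s P)) as H.
    rewrite Cmod_R, Rabs_pos_eq in H by lra. lra. }
  specialize (HK s L Hs HL). pose proof (Cmod_euler_sqr_le m s P) as HE.
  set (S := rsum (fun p => Re (chi m p) * wt s p) P) in *.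
  assert (rsum (fun p => wt s p ^ 2) P <= W) as HW2.
  { eapply Rle_trans; [|apply (HW P), prime_list_NoDup; auto].
    apply rsum_le; intros; apply wt_sqr_le; lra. }
  assert (Cmod (euler m s P) ^ 2 <= exp (- (2 * S)) * exp W) as HE2.
  { eapply Rle_trans; [apply HE|]. rewrite <- exp_plus. apply exp_le_exp. lra. }
  rewrite exp_Ropp in HE2.
  pose proof (Cmod_ge_0 L). pose proof (Cmod_ge_0 (euler m s P)).
  pose proof (exp_pos (2 * S)) as X. pose proof (exp_pos W) as XW.
  assert (25 <= K ^ 2 * (/ exp (2 * S) * exp W)) as H25.
  { apply Rle_trans with (K ^ 2 * Cmod (euler m s P) ^ 2).
    - replace (K ^ 2 * Cmod (euler m s P) ^ 2) with ((K * Cmod (euler m s P)) ^ 2) by ring.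
      assert (5 <= K * Cmod (euler m s P)) by nra. nra.
    - apply Rmult_le_compat_l; [apply pow2_ge_0 | auto]. }
  assert (25 * exp (2 * S) <= K ^ 2 * exp W) as HF.
  { replace (K ^ 2 * exp W) with (K ^ 2 * (/ exp (2 * S) * exp W) * exp (2 * S)) by (field; lra).
    apply Rmult_le_compat_r; lra. }
  pose proof (exp_ineq1_le (2 * S)). pose proof (exp_pos (2 * S)).
  assert (S <= 25 * exp (2 * S)) by lra. lra.
Qed.

(** [K] is chosen before [T]: the nontrivial sums stay bounded while the trivial one grows. *)
Lemma prime_sums (M : nat) :
  exists K, forall T, exists s P, 1 < s <= 2 /\ prime_list P /\ T <= rsum (wt s) P /\
    forall m, (1 <= m <= M)%nat -> rsum (fun p => Re (chi m p) * wt s p) P <= K.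
Proof.
  assert (exists K, forall m s P, (1 <= m <= M)%nat -> 1 < s <= 2 -> prime_list P ->
    (forall L, has_sum (heckef m s) L -> Cmod (L * euler m s P - RtoC 6) <= 1) ->
    rsum (fun p => Re (chi m p) * wt s p) P <= K) as (K & HK).
  { induction M as [|M (K & HK)].
    - exists 0. intros; lia.
    - destruct (prime_sum_upper (S M)) as (K' & HK'); [lia|].
      exists (Rmax K K'). intros m s P Hm Hs HP H6.
      destruct (Nat.eq_dec m (S M)) as [->|Hne].
      + eapply Rle_trans; [|apply Rmax_r]. apply HK'; auto.
      + eapply Rle_trans; [|apply Rmax_l]. apply HK; auto. lia. }
  exists K. intros T.
  (* The product of [L] and [euler 0 s P] is within 1 of 6, so its modulus is at most 7;
     [|L| >= 7 exp(2 T)] then forces the Euler factor down to [exp(-2 T)]. *)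
  destruct (zeta_unbounded (7 * exp (2 * T))) as (s & Hs & HZ).
  destruct (sieve_near_6 s) as (P & HP & H6); [lra|].
  exists s, P. split; auto. split; auto. split; [|intros m Hm; apply HK; auto].
  destruct (heckef_has_sum 0 s) as (L & HL); [lra|].
  specialize (HZ L HL). specialize (H6 0%nat L HL).
  pose proof (Cmod_euler_trivial_ge s P ltac:(lra) HP) as HE.
  assert (Cmod L * Cmod (euler 0 s P) <= 7) as H7.
  { rewrite <- Cmod_mult. pose proof (Cmod_le_add (L * euler 0 s P) (RtoC 6)) as H.
    rewrite Cmod_minus_sym in H6. rewrite Cmod_R, Rabs_pos_eq in H by lra. lra. }
  rewrite exp_Ropp in HE. pose proof (exp_pos (2 * rsum (wt s) P)) as X.
  pose proof (exp_pos (2 * T)) as XT.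
  apply Rnot_lt_le; intros Hlt.
  assert (exp (2 * rsum (wt s) P) < exp (2 * T)) as Hx by (apply exp_increasing; lra).
  assert (7 * exp (2 * T) * / exp (2 * rsum (wt s) P) <= 7) as Hy.
  { eapply Rle_trans; [|apply H7]. apply Rmult_le_compat; auto; [lra|].
    left; apply Rinv_0_lt_compat; auto. }
  apply (Rmult_le_compat_r (exp (2 * rsum (wt s) P))) in Hy; [|lra].
  rewrite Rmult_assoc, Rinv_l in Hy; lra.
Qed.

(** * A trigonometric polynomial *)

(* Pascal's triangle, with value 0 above the diagonal (unlike [Binomial.C]). *)
Fixpoint bin (n j : nat) : R :=
  match n with
  | O => match j with O => 1 | _ => 0 end
  | S n' => bin n' j + match j with O => 0 | S j' => bin n' j' end
  end.

Definition prv (c : nat -> R) (j : nat) : R := match j with O => 0 | S i => c i end.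

Lemma bin_S n j : bin (S n) j = bin n j + prv (bin n) j.
Proof. reflexivity. Qed.

Lemma bin_nonneg n j : 0 <= bin n j.
Proof.
  revert j; induction n as [|n IH]; intros [|j]; simpl; try lra.
  - pose proof (IH 0%nat); lra.
  - pose proof (IH j); pose proof (IH (S j)); lra.
Qed.

Lemma bin_above n j : (n < j)%nat -> bin n j = 0.
Proof.
  revert j; induction n as [|n IH]; intros [|j] H; simpl; try lia; auto.
  rewrite !IH by lia. ring.
Qed.

Lemma bin_ratio n j : (INR j + 1) * bin n (S j) = (INR n - INR j) * bin n j.
Proof.
  revert j; induction n as [|n IH]; intros j.
  - destruct j as [|j]; simpl; ring.
  - rewrite !bin_S, S_INR. cbn [prv]. rewrite Rmult_plus_distr_l, IH.
    destruct j as [|j].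
    + simpl; ring.
    + cbn [prv]. pose proof (IH j) as IHj. rewrite S_INR in *. lra.
Qed.

Lemma rsum_prv (c e : nat -> R) k :
  rsum (fun j => prv c j * e j) (seq 0 (S k)) = rsum (fun j => c j * e (S j)) (seq 0 k).
Proof.
  change (seq 0 (S k)) with (0%nat :: seq 1 k). rewrite <- seq_shift.
  change (rsum (fun j => prv c j * e j) (0%nat :: map S (seq 0 k)))
    with (0 * e 0%nat + rsum (fun j => prv c j * e j) (map S (seq 0 k))).
  rewrite rsum_map. simpl. ring.
Qed.

Lemma rsum_bin_extend n (e : nat -> R) :
  rsum (fun j => bin n j * e j) (seq 0 (S (S n))) = rsum (fun j => bin n j * e j) (seq 0 (S n)).
Proof.
  rewrite (seq_S (S n)), rsum_app.
  change (rsum _ (0 + S n :: nil)%nat) with (bin n (S n) * e (S n) + 0).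
  rewrite bin_above by lia. ring.
Qed.

(** The binomial expansion of [(e^(i x / 2) + e^(-i x / 2))^n], carried out in real terms: each
    further factor shifts the frequencies by one half either way. *)
Lemma cos_pow_bin n x :
  (2 * cos (x / 2)) ^ n = rsum (fun j => bin n j * cos ((INR j - INR n / 2) * x)) (seq 0 (S n)).
Proof.
  induction n as [|n IH].
  - simpl. replace ((0 - 0 / 2) * x) with 0 by field. rewrite cos_0; ring.
  - rewrite (rsum_ext _ (fun j => bin n j * cos ((INR j - INR (S n) / 2) * x) +
      prv (bin n) j * cos ((INR j - INR (S n) / 2) * x))).
    2:{ intros j _. rewrite bin_S; ring. }
    rewrite rsum_plus.
    rewrite (rsum_bin_extend n (fun j => cos ((INR j - INR (S n) / 2) * x))).
    rewrite (rsum_prv (bin n) (fun j => cos ((INR j - INR (S n) / 2) * x))).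
    rewrite <- rsum_plus, <- tech_pow_Rmult, IH, <- rsum_scal.
    apply rsum_ext. intros j _. rewrite !S_INR.
    replace ((INR j - (INR n + 1) / 2) * x) with ((INR j - INR n / 2) * x - x / 2) by field.
    replace ((INR j + 1 - (INR n + 1) / 2) * x) with ((INR j - INR n / 2) * x + x / 2) by field.
    rewrite cos_minus, cos_plus. ring.
Qed.

Lemma cos_pow_even M x :
  (2 + 2 * cos x) ^ M =
    rsum (fun j => bin (2 * M) j * cos ((INR j - INR M) * x)) (seq 0 (S (2 * M))).
Proof.
  replace (2 + 2 * cos x) with ((2 * cos (x / 2)) ^ 2).
  - rewrite <- pow_mult, cos_pow_bin. apply rsum_ext; intros j _.
    rewrite mult_INR. do 3 f_equal. simpl; field.
  - replace x with (2 * (x / 2)) at 2 by field. rewrite cos_2a_cos. ring.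
Qed.

(* The coefficient of [cos ((j - M - 1) x)]: the constant term is at [j = M + 1]. *)
Definition trig_coef (M j : nat) : R :=
  (INR M + 2) / 2 * bin (2 * S M) j - (2 * INR M + 3) * prv (bin (2 * M)) j.

Definition trig_poly (M : nat) (y : R) : R :=
  (2 + 2 * y) ^ M * ((INR M + 2) * y - (INR M + 1)).

(** The linear factor is [(M + 2) / 2 * (2 + 2 cos x) - (2 M + 3)], so the polynomial combines two
    consecutive powers of [2 + 2 cos x], that is, two rows of Pascal's triangle. *)
Lemma trig_poly_expand M x :
  trig_poly M (cos x) =
    rsum (fun j => trig_coef M j * cos ((INR j - INR (S M)) * x)) (seq 0 (S (2 * S M))).
Proof.
  rewrite (rsum_ext _ (fun j =>
    (INR M + 2) / 2 * (bin (2 * S M) j * cos ((INR j - INR (S M)) * x)) +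
    - (2 * INR M + 3) * (prv (bin (2 * M)) j * cos ((INR j - INR (S M)) * x)))).
  2:{ intros j _. unfold trig_coef. ring. }
  rewrite rsum_plus, !rsum_scal, <- cos_pow_even.
  rewrite (rsum_prv (bin (2 * M)) (fun j => cos ((INR j - INR (S M)) * x))).
  replace (2 * S M)%nat with (S (S (2 * M))) by lia.
  rewrite (rsum_bin_extend (2 * M) (fun j => cos ((INR (S j) - INR (S M)) * x))).
  rewrite (rsum_ext _ (fun j => bin (2 * M) j * cos ((INR j - INR M) * x))).
  2:{ intros j _. rewrite !S_INR. do 3 f_equal. ring. }
  rewrite <- cos_pow_even, <- tech_pow_Rmult. unfold trig_poly. field.
Qed.

(** Brings both rows in [trig_coef] to a single binomial coefficient, so that its sign becomes a
    polynomial inequality. *)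
Lemma bin_two_up n j :
  (INR j + 1) * (INR n + 1 - INR j) * bin (S (S n)) (S j) =
    (INR n + 2) * (INR n + 1) * bin n j.
Proof.
  pose proof (bin_ratio n j) as R1.
  assert (bin (S (S n)) (S j) = bin n (S j) + 2 * bin n j + prv (bin n) j) as ->.
  { rewrite bin_S. cbn [prv]. rewrite (bin_S n (S j)), (bin_S n j). cbn [prv]. ring. }
  assert ((INR n + 1 - INR j) * prv (bin n) j = INR j * bin n j) as R2.
  { destruct j as [|j]; [simpl; ring|]. cbn [prv]. pose proof (bin_ratio n j) as R.
    rewrite S_INR in *. lra. }
  replace ((INR j + 1) * (INR n + 1 - INR j) * (bin n (S j) + 2 * bin n j + prv (bin n) j))
    with ((INR n + 1 - INR j) * ((INR j + 1) * bin n (S j)) +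
      2 * (INR j + 1) * (INR n + 1 - INR j) * bin n j +
      (INR j + 1) * ((INR n + 1 - INR j) * prv (bin n) j)) by ring.
  rewrite R1, R2. ring.
Qed.

Lemma trig_coef_nonneg M j : (1 <= M)%nat -> j <> S M -> 0 <= trig_coef M j.
Proof.
  intros HM Hj. unfold trig_coef. pose proof (bin_nonneg (2 * S M) j) as B0.
  assert (1 <= INR M) as M1 by (apply (le_INR 1); auto).
  destruct j as [|j]; cbn [prv]; [nra|].
  destruct (Nat.lt_ge_cases (2 * M) j) as [Hlt|Hle].
  { rewrite (bin_above (2 * M) j) by auto. nra. }
  replace (2 * S M)%nat with (S (S (2 * M))) in * by lia.
  pose proof (bin_two_up (2 * M) j) as R. pose proof (bin_nonneg (2 * M) j) as b0.
  rewrite mult_INR in R. change (INR 2) with 2 in R.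
  apply le_INR in Hle. rewrite mult_INR in Hle. change (INR 2) with 2 in Hle.
  pose proof (pos_INR j).
  assert (1 <= (INR j - INR M) ^ 2) as N1.
  { destruct (Nat.lt_ge_cases j M) as [H1|H1].
    - apply (le_INR (S j) M) in H1. rewrite S_INR in H1. nra.
    - assert (S M <= j)%nat as H2 by lia. apply le_INR in H2. rewrite S_INR in H2. nra. }
  set (B := bin (S (S (2 * M))) (S j)) in *. set (b := bin (2 * M) j) in *.
  set (m := INR M) in *. set (i := INR j) in *. clearbody B b m i.
  assert (0 < (i + 1) * (2 * m + 1 - i)) as Q by nra.
  apply (Rmult_le_reg_l ((i + 1) * (2 * m + 1 - i))); auto. rewrite Rmult_0_r.
  replace ((i + 1) * (2 * m + 1 - i) * ((m + 2) / 2 * B - (2 * m + 3) * b))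
    with ((m + 2) / 2 * ((i + 1) * (2 * m + 1 - i) * B) -
      (2 * m + 3) * ((i + 1) * (2 * m + 1 - i)) * b) by ring.
  rewrite R.
  (* Uses [(i + 1)(2 m + 1 - i) = (m + 1)^2 - (i - m)^2]. The bracket is at least [m + 2] once
     [(i - m)^2 >= 1], but equals [-(m + 1)] at [i = m]: only the centre is negative. *)
  replace ((m + 2) / 2 * ((2 * m + 2) * (2 * m + 1) * b) -
    (2 * m + 3) * ((i + 1) * (2 * m + 1 - i)) * b)
    with (b * ((m + 2) * (m + 1) * (2 * m + 1) -
      (2 * m + 3) * ((m + 1) ^ 2 - (i - m) ^ 2))) by field.
  apply Rmult_le_pos; auto. nra.
Qed.

Lemma trig_coef_center M : trig_coef M (S M) = - bin (2 * M) M / (INR M + 1).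
Proof.
  unfold trig_coef; cbn [prv]. replace (2 * S M)%nat with (S (S (2 * M))) by lia.
  pose proof (bin_two_up (2 * M) M) as R. rewrite mult_INR in R. change (INR 2) with 2 in R.
  pose proof (pos_INR M).
  assert (bin (S (S (2 * M))) (S M) = (4 * INR M + 2) * bin (2 * M) M / (INR M + 1)) as ->.
  { apply (Rmult_eq_reg_l ((INR M + 1) * (2 * INR M + 1 - INR M))); [rewrite R; field; lra|]. nra. }
  field. lra.
Qed.

Lemma bin_central_lower M : 4 ^ M <= (2 * INR M + 1) * bin (2 * M) M.
Proof.
  induction M as [|M IH]; [simpl; lra|].
  replace (2 * S M)%nat with (S (S (2 * M))) by lia.
  pose proof (bin_two_up (2 * M) M) as R. rewrite mult_INR in R. change (INR 2) with 2 in R.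
  pose proof (pos_INR M). rewrite S_INR, <- tech_pow_Rmult.
  assert (bin (S (S (2 * M))) (S M) = (4 * INR M + 2) * bin (2 * M) M / (INR M + 1)) as ->.
  { apply (Rmult_eq_reg_l ((INR M + 1) * (2 * INR M + 1 - INR M))); [rewrite R; field; lra|]. nra. }
  set (b := bin (2 * M) M) in *. set (m := INR M) in *. clearbody b m.
  apply (Rmult_le_reg_r (m + 1)); [lra|].
  replace ((2 * (m + 1) + 1) * ((4 * m + 2) * b / (m + 1)) * (m + 1))
    with ((2 * m + 3) * 2 * ((2 * m + 1) * b)) by (field; lra).
  pose proof (pow_lt 4 M ltac:(lra)). nra.
Qed.

(** For [q > 0], Bernoulli's inequality for [(1 + x)^k] with [1 + x = 1 / q], raised to the fourth
    power, gives growth of degree 4 against a cubic. The 1000 covers [2 * 11 * 9 * 5 = 990]. *)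
Lemma exp_beats_cubic q : 0 <= q < 1 -> exists M, (1 <= M)%nat /\
  2 * ((2 * INR M + 3) * ((2 * INR M + 1) * (INR M + 1))) * q ^ M <= 1.
Proof.
  intros Hq. destruct (Req_dec q 0) as [->|Q0].
  { exists 1%nat; split; auto. simpl. lra. }
  set (x := / q - 1).
  assert (0 < x).
  { unfold x. assert (1 < / q); [|lra]. rewrite <- Rinv_1. apply Rinv_lt_contravar; lra. }
  destruct (INR_unbounded (1000 / x ^ 4)) as (n & Hn).
  set (k := S n). assert (1000 <= INR k * x ^ 4) as Hk.
  { unfold k. rewrite S_INR. pose proof (pow_lt x 4 H).
    apply (Rmult_lt_compat_r (x ^ 4)) in Hn; auto.
    unfold Rdiv in Hn. rewrite Rmult_assoc, Rinv_l in Hn by lra. nra. }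
  assert (1 <= INR k) as K1 by (apply (le_INR 1); unfold k; lia).
  exists (k * 4)%nat; split; [unfold k; lia|].
  rewrite mult_INR. replace (INR 4) with 4 by (simpl; ring).
  assert (1 + INR k * x <= (1 + x) ^ k) as Be by (apply poly; auto).
  assert ((INR k * x) ^ 4 <= (1 + x) ^ (k * 4)) as B4.
  { rewrite pow_mult. apply pow_incr. split; [apply Rmult_le_pos; lra | lra]. }
  assert (q ^ (k * 4) * (1 + x) ^ (k * 4) = 1) as Inv.
  { rewrite <- Rpow_mult_distr. replace (q * (1 + x)) with 1 by (unfold x; field; auto). apply pow1. }
  assert (0 < q ^ (k * 4)) as Qp by (apply pow_lt; lra).
  set (y := INR k) in *.
  assert (2 * ((2 * (y * 4) + 3) * ((2 * (y * 4) + 1) * (y * 4 + 1)))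
    <= 1000 * y ^ 3) as Po.
  { assert (2 * (y * 4) + 3 <= 11 * y) by lra.
    assert ((2 * (y * 4) + 1) * (y * 4 + 1) <= (9 * y) * (5 * y)).
    { apply Rmult_le_compat; lra. }
    assert ((2 * (y * 4) + 3) * ((2 * (y * 4) + 1) * (y * 4 + 1))
      <= (11 * y) * ((9 * y) * (5 * y))).
    { apply Rmult_le_compat; nra. }
    assert (0 < y ^ 3) by (apply pow_lt; lra). simpl in *. nra. }
  assert (1000 * y ^ 3 <= (y * x) ^ 4).
  { replace ((y * x) ^ 4) with (y * x ^ 4 * y ^ 3) by ring.
    apply Rmult_le_compat_r; [apply pow_le; lra | auto]. }
  apply Rle_trans with ((1 + x) ^ (k * 4) * q ^ (k * 4)); [|lra].
  apply Rmult_le_compat_r; lra.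
Qed.

Lemma rsum_exchange {T U} (f : T -> U -> R) A B :
  rsum (fun a => rsum (f a) B) A = rsum (fun b => rsum (fun a => f a b) A) B.
Proof.
  induction A as [|a A IH]; simpl.
  - induction B as [|b B IHB]; simpl; [auto | rewrite <- IHB; ring].
  - rewrite IH, <- rsum_plus. auto.
Qed.

Lemma rsum_indicator_le {T} (c : T) (a : R) (l : list T) : a <= 0 -> In c l ->
  rsum (fun x => if excluded_middle_informative (x = c) then a else 0) l <= a.
Proof.
  intros Ha. induction l as [|x l IH]; simpl; [tauto|]. intros H.
  assert (rsum (fun y => if excluded_middle_informative (y = c) then a else 0) l <= 0) as R0.
  { clear - Ha. induction l as [|y l IH]; simpl; [lra|].
    destruct excluded_middle_informative; lra. }
  destruct excluded_middle_informative as [|N]; [lra|].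
  destruct H as [H|H]; [congruence|]. specialize (IH H). lra.
Qed.

(** * Primes of small nonzero argument *)

Lemma chi_cos p : p <> e0 -> exists x, forall m, Re (chi m p) = cos (INR m * x).
Proof.
  intros Hp. pose proof (Cmod_toC_pos p Hp) as P. destruct (polar _ P) as (t & Ht).
  exists (6 * t). intros m. rewrite (chi_polar m p _ t P Ht). reflexivity.
Qed.

Lemma prime_small_angle c : 0 <= c < 1 -> exists p, eprime p /\ c < Re (chi 1 p) < 1.
Proof.
  intros Hc. apply NNPP; intros Hno.
  assert (forall p, eprime p -> Re (chi 1 p) <= c \/ Re (chi 1 p) = 1) as Far.
  { intros p Hp. destruct (Rle_dec (Re (chi 1 p)) c) as [|Hn]; [auto|right].
    assert (Re (chi 1 p) <= 1).
    { destruct (chi_cos p) as (x & Hx); [apply Hp|]. rewrite Hx. apply COS_bound. }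
    destruct (Req_dec (Re (chi 1 p)) 1); auto. exfalso; apply Hno. exists p; split; auto; lra. }
  destruct (exp_beats_cubic ((1 + c) / 2)) as (M & M1 & HM); [lra|].
  destruct (prime_sums (S M)) as (K & HK).
  set (D := rsum (fun j => Rabs (trig_coef M j)) (seq 0 (S (2 * S M)))).
  set (h := 4 ^ M / ((2 * INR M + 1) * (INR M + 1))).
  pose proof (pos_INR M) as PM.
  assert (0 < 4 ^ M) as P4 by (apply pow_lt; lra).
  assert (0 < h) as Hh by (apply Rdiv_lt_0_compat; nra).
  (* [Lower], [Upper] and [Gap] below together give [(h / 2) W <= |K| D]; this threshold makes
     [(h / 2) W] at least [|K| D + 1]. *)
  destruct (HK ((Rabs K * D + 1) * 2 / h)) as (s & P & Hs & HP & HT & HU).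
  set (W := rsum (wt s) P) in *.
  assert (0 <= W) as W0 by (apply rsum_nonneg; intros; apply wt_nonneg).
  assert (- ((2 * INR M + 3) * (2 + 2 * c) ^ M) * W <=
    rsum (fun p => wt s p * trig_poly M (Re (chi 1 p))) P) as Lower.
  { unfold W. rewrite <- rsum_scal. apply rsum_le. intros p Hp.
    rewrite Rmult_comm. apply Rmult_le_compat_l; [apply wt_nonneg|].
    assert (-1 <= Re (chi 1 p)) as C1.
    { destruct (chi_cos p) as (x & Hx); [apply (prime_list_prime P); auto|].
      rewrite Hx. apply COS_bound. }
    unfold trig_poly.
    assert (0 < (2 + 2 * c) ^ M) by (apply pow_lt; lra).
    (* For [-1 <= y <= c] the linear factor is at least [-(2 M + 3)]; at [y = 1] the polynomial is
       [4^M], which is positive. *)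
    destruct (Far p (prime_list_prime P p HP Hp)) as [F|F].
    - set (y := Re (chi 1 p)) in *.
      assert (0 <= (2 + 2 * y) ^ M <= (2 + 2 * c) ^ M) as B.
      { split; [apply pow_le; lra | apply pow_incr; lra]. }
      assert (- (2 * INR M + 3) <= (INR M + 2) * y - (INR M + 1)) by nra. nra.
    - rewrite F. assert (0 < (2 + 2 * 1) ^ M) by (apply pow_lt; lra). nra. }
  (* With truncated subtraction, [(S M - j) + (j - S M)] is [|j - (M + 1)|]; the cosine is even, and
     the value never exceeds the range [M + 1] covered by [K]. *)
  assert (rsum (fun p => wt s p * trig_poly M (Re (chi 1 p))) P =
    rsum (fun j => trig_coef M j *
      rsum (fun p => Re (chi ((S M - j) + (j - S M)) p) * wt s p) P)
      (seq 0 (S (2 * S M)))) as Ex.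
  { rewrite (rsum_ext _ (fun p => rsum (fun j => trig_coef M j *
      (Re (chi ((S M - j) + (j - S M)) p) * wt s p))
      (seq 0 (S (2 * S M))))).
    - rewrite rsum_exchange. apply rsum_ext. intros j _. rewrite rsum_scal. auto.
    - intros p Hp. destruct (chi_cos p) as (x & Hx); [apply (prime_list_prime P); auto|].
      rewrite Hx, Rmult_1_l, trig_poly_expand, <- rsum_scal. apply rsum_ext. intros j _.
      rewrite Hx.
      replace (cos ((INR j - INR (S M)) * x))
        with (cos (INR ((S M - j) + (j - S M)) * x)); [ring|].
      rewrite plus_INR. destruct (Nat.le_ge_cases j (S M)) as [L|L].
      + replace (j - S M)%nat with 0%nat by lia. rewrite minus_INR by auto.
        rewrite <- cos_neg. f_equal. simpl (INR 0). ring.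
      + replace (S M - j)%nat with 0%nat by lia. rewrite minus_INR by auto.
        f_equal. simpl (INR 0). ring. }
  (* Off the centre the coefficients are nonnegative, so upper bounds on the character sums apply;
     at the centre the character is trivial and the sum is [W] itself. *)
  assert (rsum (fun p => wt s p * trig_poly M (Re (chi 1 p))) P <= Rabs K * D + - h * W) as Upper.
  { rewrite Ex.
    apply Rle_trans with (rsum (fun j => Rabs K * Rabs (trig_coef M j) +
      (if excluded_middle_informative (j = S M) then - h * W else 0)) (seq 0 (S (2 * S M)))).
    - apply rsum_le. intros j Hj. apply in_seq in Hj.
      pose proof (Rabs_pos K). pose proof (Rabs_pos (trig_coef M j)).
      destruct excluded_middle_informative as [->|Hne].
      + rewrite Nat.sub_diag.
        rewrite (rsum_ext _ (wt s)).
        2:{ intros p _. unfold chi; simpl. ring. }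
        fold W. rewrite trig_coef_center.
        assert (- bin (2 * M) M / (INR M + 1) <= - h).
        { unfold h. pose proof (bin_central_lower M) as BL.
          apply (Rmult_le_reg_r ((2 * INR M + 1) * (INR M + 1))); [nra|].
          replace (- bin (2 * M) M / (INR M + 1) * ((2 * INR M + 1) * (INR M + 1)))
            with (- ((2 * INR M + 1) * bin (2 * M) M)) by (field; lra).
          replace (- (4 ^ M / ((2 * INR M + 1) * (INR M + 1))) * ((2 * INR M + 1) * (INR M + 1)))
            with (- 4 ^ M) by (field; lra). lra. }
        pose proof (Rabs_pos (- bin (2 * M) M / (INR M + 1))). nra.
      + rewrite Rplus_0_r. pose proof (trig_coef_nonneg M j M1 Hne) as T0.
        rewrite (Rabs_pos_eq (trig_coef M j)) by auto. rewrite Rmult_comm.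
        apply Rmult_le_compat_r; auto.
        eapply Rle_trans; [apply HU; lia | apply Rle_abs].
    - rewrite rsum_plus, rsum_scal. fold D. apply Rplus_le_compat_l.
      apply rsum_indicator_le; [nra|]. apply in_seq. lia. }
  assert ((2 * INR M + 3) * (2 + 2 * c) ^ M <= h / 2) as Gap.
  { replace (2 + 2 * c) with (4 * ((1 + c) / 2)) by field. rewrite Rpow_mult_distr.
    unfold h. apply (Rmult_le_reg_r (2 * ((2 * INR M + 1) * (INR M + 1)))); [nra|].
    replace (4 ^ M / ((2 * INR M + 1) * (INR M + 1)) / 2 * (2 * ((2 * INR M + 1) * (INR M + 1))))
      with (4 ^ M * 1) by (field; nra).
    replace ((2 * INR M + 3) * (4 ^ M * ((1 + c) / 2) ^ M) *
      (2 * ((2 * INR M + 1) * (INR M + 1))))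
      with (4 ^ M * (2 * ((2 * INR M + 3) * ((2 * INR M + 1) * (INR M + 1))) * ((1 + c) / 2) ^ M))
      by ring.
    apply Rmult_le_compat_l; lra. }
  apply (Rmult_le_compat_r (h / 2)) in HT; [|lra].
  replace ((Rabs K * D + 1) * 2 / h * (h / 2)) with (Rabs K * D + 1) in HT by (field; lra).
  nra.
Qed.

(** * Lattice points of norm a power of a prime *)

Lemma cis_period x (d : Z) : cis (x + 2 * IZR d * PI) = cis x.
Proof.
  assert (forall y n, cis (y + 2 * INR n * PI) = cis y) as N.
  { intros y n. unfold cis. rewrite cos_period, sin_period. auto. }
  destruct (Z_le_dec 0 d) as [H|H].
  - rewrite <- (Z2Nat.id d) by auto. rewrite <- INR_IZR_INZ. auto.
  - rewrite <- (N (x + 2 * IZR d * PI) (Z.to_nat (- d))).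
    rewrite INR_IZR_INZ, Z2Nat.id, opp_IZR by lia. f_equal; ring.
Qed.

Lemma angle_mod x : exists phi (q : Z), x = phi + 2 * IZR q * PI /\ Rabs phi <= PI.
Proof.
  pose proof PI_RGT_0 as P.
  set (y := x / (2 * PI) - 1 / 2). pose proof (archimed y) as A.
  assert (x = 2 * PI * (y + 1 / 2)) as Ex by (unfold y; field; lra).
  exists (x - 2 * IZR (up y) * PI), (up y). split; [ring|]. apply Rabs_le. nra.
Qed.

Lemma cos_gt_near d phi : 0 < d <= PI -> Rabs phi <= PI -> cos d < cos phi -> Rabs phi < d.
Proof.
  intros Hd Hp Hc. apply Rnot_le_lt; intros H.
  assert (cos (Rabs phi) = cos phi) as E0.
  { unfold Rabs. destruct Rcase_abs; auto. apply cos_neg. }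
  pose proof (cos_decr_1 d (Rabs phi) ltac:(lra) ltac:(lra) ltac:(lra) Hp H). lra.
Qed.

Lemma cos_small_lt_1 x : 0 < x <= 1 -> cos x < 1.
Proof.
  intros H. pose proof PI2_1. rewrite <- cos_0. apply cos_decreasing_1; lra.
Qed.

Lemma toC_unit u : enorm u = 1%Z -> exists q : Z, toC u = cis (IZR q * PI / 3).
Proof.
  assert (toC (0, 1)%Z = cis (IZR 1 * PI / 3)) as W.
  { unfold toC, cis; simpl. rewrite Rmult_1_l. fold omega. ring. }
  assert (step : forall x q, toC x = cis (IZR q * PI / 3) ->
    toC (emul (0, 1)%Z x) = cis (IZR (1 + q) * PI / 3)).
  { intros x q Hx. rewrite toC_mul, W, Hx, <- cis_add, plus_IZR. f_equal; field. }
  intros H. apply norm_1_units in H. simpl in H.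
  assert (toC (1, 0)%Z = cis (IZR 0 * PI / 3)) as H0.
  { replace (IZR 0 * PI / 3) with 0 by field. rewrite cis_0, toC_pair.
    unfold RtoC; simpl; f_equal; field. }
  pose proof (step _ _ W) as H2. pose proof (step _ _ H2) as H3.
  pose proof (step _ _ H3) as H4. pose proof (step _ _ H4) as H5.
  destruct H as [<-|[<-|[<-|[<-|[<-|[<-|[]]]]]]]; eexists; eauto.
Qed.

(** [p] divides [N(x) = x conj(x)], hence [x] or [conj(x)]; in the latter case conjugate. Each
    factor so removed turns the argument by plus or minus [phi / 6], up to multiples of [pi / 3]. *)
Lemma prime_power_norm p n x : eprime p -> enorm x = (enorm p ^ Z.of_nat (S n))%Z ->
  exists z, enorm z = (enorm p ^ Z.of_nat n)%Z /\ (x = emul p z \/ x = emul (econj p) z).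
Proof.
  intros Hp Hx. destruct Hp as (P0 & _ & Pp). pose proof (norm_pos p P0) as Np.
  rewrite Nat2Z.inj_succ, Z.pow_succ_r in Hx by lia.
  assert (edvd p (emul x (econj x))) as D.
  { exists (emul (econj p) ((enorm p ^ Z.of_nat n)%Z, 0%Z)).
    rewrite emul_conj, Hx.
    replace (emul p (emul (econj p) ((enorm p ^ Z.of_nat n)%Z, 0%Z)))
      with (emul (emul p (econj p)) ((enorm p ^ Z.of_nat n)%Z, 0%Z)) by ring.
    rewrite emul_conj. unfold emul; cbn [fst snd]. f_equal; ring. }
  destruct (Pp _ _ D) as [(z & Hz)|(z & Hz)].
  - exists z; split; [|auto]. rewrite Hz, norm_mul in Hx. apply Z.mul_cancel_l in Hx; lia.
  - assert (x = emul (econj p) (econj z)) as Ex.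
    { rewrite <- econj_mul, <- Hz, econj_conj. auto. }
    exists (econj z); split; [|auto].
    rewrite Ex, norm_mul, norm_conj in Hx. apply Z.mul_cancel_l in Hx; lia.
Qed.

Lemma prime_power_angles p r phi (q0 : Z) n x :
  eprime p -> toC p = (RtoC r * cis (phi / 6 + IZR q0 * PI / 3))%C ->
  enorm x = (enorm p ^ Z.of_nat n)%Z ->
  exists j q : Z, (Z.abs j <= Z.of_nat n)%Z /\
    toC x = (RtoC (r ^ n) * cis (IZR j * (phi / 6) + IZR q * PI / 3))%C.
Proof.
  intros Hp Ht. revert x. induction n as [|n IH]; intros x Hx.
  - destruct (toC_unit x) as (q & Hq); [rewrite Hx; reflexivity|].
    exists 0%Z, q. split; [simpl; lia|]. rewrite Hq. simpl.
    replace (0 * (phi / 6) + IZR q * PI / 3) with (IZR q * PI / 3) by ring. ring.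
  - destruct (prime_power_norm p n x Hp Hx) as (z & Hz & Hxz).
    destruct (IH z Hz) as (j & q & Hj & Tz).
    assert (toC (econj p) = (RtoC r * cis (- (phi / 6) + - IZR q0 * PI / 3))%C) as Tc.
    { rewrite toC_conj, Ht.
      replace (- (phi / 6) + - IZR q0 * PI / 3) with (- (phi / 6 + IZR q0 * PI / 3)) by field.
      unfold cis, Cconj, Cmult, RtoC; simpl. rewrite cos_neg, sin_neg. f_equal; ring. }
    destruct Hxz as [->| ->].
    + exists (j + 1)%Z, (q + q0)%Z. split; [lia|].
      rewrite toC_mul, Ht, Tz, !plus_IZR, <- tech_pow_Rmult, RtoC_mult.
      replace ((IZR j + 1) * (phi / 6) + (IZR q + IZR q0) * PI / 3)
        with ((phi / 6 + IZR q0 * PI / 3) + (IZR j * (phi / 6) + IZR q * PI / 3)) by field.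
      rewrite (cis_add (phi / 6 + IZR q0 * PI / 3)). ring.
    + exists (j - 1)%Z, (q - q0)%Z. split; [lia|].
      rewrite toC_mul, Tc, Tz, !minus_IZR, <- tech_pow_Rmult, RtoC_mult.
      replace ((IZR j - 1) * (phi / 6) + (IZR q - IZR q0) * PI / 3)
        with ((- (phi / 6) + - IZR q0 * PI / 3) + (IZR j * (phi / 6) + IZR q * PI / 3)) by field.
      rewrite (cis_add (- (phi / 6) + - IZR q0 * PI / 3)). ring.
Qed.

Fixpoint epow (x : E) (n : nat) : E :=
  match n with O => e1 | S n' => emul x (epow x n') end.

Lemma toC_epow x n r t : toC x = (RtoC r * cis t)%C ->
  toC (epow x n) = (RtoC (r ^ n) * cis (INR n * t))%C.
Proof.
  intros H. induction n as [|n IH].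
  - simpl. rewrite Rmult_0_l, cis_0, toC_pair. unfold RtoC, Cmult; simpl. f_equal; field.
  - simpl epow. rewrite toC_mul, IH, H, S_INR, <- tech_pow_Rmult, RtoC_mult.
    replace ((INR n + 1) * t) with (t + INR n * t) by ring. rewrite cis_add. ring.
Qed.

Lemma power_products_distinct r phi (q0 : Z) (k a b : nat) :
  0 < r -> phi <> 0 -> INR (k + 1) * Rabs phi <= 1 -> (a < b <= k)%nat ->
  (RtoC r * cis ((2 * INR a - INR k) * (phi / 6 + IZR q0 * PI / 3)))%C <>
  (RtoC r * cis ((2 * INR b - INR k) * (phi / 6 + IZR q0 * PI / 3)))%C.
Proof.
  intros Hr Hphi Hk Hab E0. set (t := phi / 6 + IZR q0 * PI / 3) in *.
  apply (f_equal dir) in E0. rewrite !dir_polar in E0 by auto.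
  assert (cis (2 * INR (b - a) * t) = RtoC 1) as E1.
  { rewrite minus_INR by lia.
    replace (2 * (INR b - INR a) * t)
      with ((2 * INR b - INR k) * t + - ((2 * INR a - INR k) * t)) by ring.
    rewrite cis_add, <- E0, <- cis_add, Rplus_opp_r. apply cis_0. }
  (* Cubing turns [2 (b - a) t] into [(b - a) 6 t], which is [(b - a) phi] modulo [2 pi]: the
     unknown multiple of [pi / 3] disappears. The remaining angle has modulus in [(0, 1]], so its
     cosine is not 1. *)
  apply (f_equal (fun z => (z ^ 3)%C)) in E1. rewrite cis_pow, Cpow_1_l in E1.
  replace (INR 3 * (2 * INR (b - a) * t))
    with (INR (b - a) * phi + 2 * IZR (Z.of_nat (b - a) * q0) * PI) in E1.
  2:{ rewrite mult_IZR, <- INR_IZR_INZ. unfold t. simpl (INR 3). field. }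
  rewrite cis_period in E1. apply (f_equal Re) in E1. unfold cis, Re, RtoC in E1; simpl in E1.
  assert (1 <= INR (b - a) <= INR (k + 1)) as B.
  { split; [apply (le_INR 1); lia | apply le_INR; lia]. }
  pose proof (Rabs_pos_lt phi Hphi).
  assert (cos (INR (b - a) * Rabs phi) < 1) as L by (apply cos_small_lt_1; nra).
  unfold Rabs in L. destruct Rcase_abs; [|lra].
  replace (INR (b - a) * - phi) with (- (INR (b - a) * phi)) in L by ring.
  rewrite cos_neg in L. lra.
Qed.

Lemma angle_reduce (q : Z) y : exists nu : nat, (nu <= 5)%nat /\
  cis (y + IZR q * PI / 3) = cis (INR nu * PI / 3 + y).
Proof.
  pose proof (Z.mod_pos_bound q 6 ltac:(lia)) as B.
  pose proof (Z.div_mod q 6 ltac:(lia)) as D.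
  exists (Z.to_nat (q mod 6)). split; [lia|].
  rewrite <- (cis_period (INR (Z.to_nat (q mod 6)) * PI / 3 + y) (q / 6)).
  rewrite INR_IZR_INZ, Z2Nat.id by lia. f_equal.
  rewrite D at 1. rewrite plus_IZR, mult_IZR. field.
Qed.

Lemma NoDup_map_distinct {T} (f : nat -> T) (n : nat) :
  (forall a b, (a < b < n)%nat -> f a <> f b) -> NoDup (map f (seq 0 n)).
Proof.
  induction n as [|n IH]; intros H; [constructor|].
  rewrite seq_S, map_app. apply NoDup_app.
  - apply IH. intros a b Hab. apply H; lia.
  - simpl. constructor; [simpl; tauto | constructor].
  - intros x Hx Hn. simpl in Hn. destruct Hn as [<-|[]].
    apply in_map_iff in Hx as (a & Ha & Hin). apply in_seq in Hin.
    apply (H a n); auto; lia.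
Qed.

Theorem theorem5p7 :
  forall (eps : R), 0 < eps -> forall k : nat,
  exists n : nat,
    (exists l : list C, NoDup l /\ (k < length l)%nat /\
       forall mu, In mu l -> in_O mu /\ (Cmod mu) ^ 2 = INR n) /\
    (forall mu : C, in_O mu -> (Cmod mu) ^ 2 = INR n -> on_six_arcs eps n mu).
Proof.
  intros eps Heps k. pose proof PI2_1 as HPI.
  (* The bound [eps] keeps every [j phi / 6] with [|j| <= k] inside the arcs; the bound 1 keeps the
     multiples of [phi] from wrapping around, so that the products are distinct. *)
  set (d := Rmin eps 1 / INR (k + 1)).
  assert (1 <= INR (k + 1)) as K1 by (apply (le_INR 1); lia).
  assert (0 < Rmin eps 1) as Hm by (apply Rmin_glb_lt; lra).
  pose proof (Rmin_l eps 1) as Ml. pose proof (Rmin_r eps 1) as Mr.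
  assert (INR (k + 1) * d = Rmin eps 1) as Dk by (unfold d; field; lra).
  assert (0 < d <= 1) as Hd by (split; nra).
  destruct (prime_small_angle (cos d)) as (p & Hp & Hc).
  { split; [apply cos_ge_0; lra | apply cos_small_lt_1; auto]. }
  assert (p <> e0) as P0 by apply Hp.
  pose proof (Cmod_toC_pos p P0) as Pr.
  destruct (polar _ Pr) as (t & Ht). set (r := Cmod (toC p)) in *.
  destruct (angle_mod (6 * t)) as (phi & q0 & E6 & Hphi).
  assert (t = phi / 6 + IZR q0 * PI / 3) as Et by lra.
  rewrite (chi_polar 1 p r t Pr Ht) in Hc. change (INR 1) with 1 in Hc.
  rewrite Rmult_1_l, E6, cis_period in Hc. unfold cis, Re in Hc; simpl in Hc.
  assert (Rabs phi < d) as Near by (apply cos_gt_near; lra).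
  assert (phi <> 0) as Phi0 by (intros ->; rewrite cos_0 in Hc; lra).
  assert (INR (Z.to_nat (enorm p ^ Z.of_nat k)) = (r ^ k) ^ 2) as HN.
  { rewrite INR_IZR_INZ, Z2Nat.id by (apply Z.pow_nonneg, norm_nonneg).
    rewrite <- pow_IZR, <- Cmod_toC_sqr. fold r. rewrite <- !pow_mult. f_equal; lia. }
  exists (Z.to_nat (enorm p ^ Z.of_nat k)). split.
  (* For [a = 0, ..., k] these are [k + 1] points of the same norm, with arguments [(2 a - k) t]. *)
  - pose (f := fun a => toC (emul (epow p a) (epow (econj p) (k - a)))).
    assert (Tc : toC (econj p) = (RtoC r * cis (- t))%C).
    { rewrite toC_conj, Ht. unfold cis, Cconj, Cmult, RtoC; simpl.
      rewrite cos_neg, sin_neg. f_equal; ring. }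
    assert (Hf : forall a, (a <= k)%nat ->
      f a = (RtoC (r ^ k) * cis ((2 * INR a - INR k) * t))%C).
    { intros a Ha. unfold f. rewrite toC_mul, (toC_epow p a r t Ht), (toC_epow _ _ _ _ Tc).
      replace k with (a + (k - a))%nat at 3 by lia. rewrite pow_add, RtoC_mult.
      replace ((2 * INR a - INR k) * t) with (INR a * t + INR (k - a) * - t)
        by (rewrite minus_INR by auto; ring).
      rewrite cis_add. ring. }
    exists (map f (seq 0 (S k))). split; [|split].
    + apply NoDup_map_distinct. intros a b Hab. rewrite !Hf, Et by lia.
      apply power_products_distinct; auto; [apply pow_lt; auto | | lia].
      apply Rle_trans with (INR (k + 1) * d); [apply Rmult_le_compat_l; lra | lra].
    + rewrite length_map, length_seq. lia.
    + intros mu Hmu. apply in_map_iff in Hmu as (a & <- & Ha). apply in_seq in Ha. split.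
      * unfold f, toC, in_O. eauto.
      * rewrite Hf, Cmod_mult, Cmod_R, Cmod_cis, Rmult_1_r, HN by lia.
        rewrite pow2_abs. auto.
  - intros mu (a & b & Hmu) Hn.
    change (mu = toC (a, b)) in Hmu. subst mu. rewrite Cmod_toC_sqr in Hn.
    rewrite INR_IZR_INZ, Z2Nat.id in Hn by (apply Z.pow_nonneg, norm_nonneg).
    apply eq_IZR in Hn. rewrite Et in Ht.
    destruct (prime_power_angles p r phi q0 k (a, b) Hp Ht Hn) as (j & q & Hj & Tx).
    destruct (angle_reduce q (IZR j * (phi / 6))) as (nu & Hnu & Er).
    exists nu; split; auto. exists (IZR j * (phi / 6)); split.
    + rewrite Rabs_mult. unfold Rdiv. rewrite Rabs_mult, (Rabs_pos_eq (/ 6)) by lra.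
      rewrite <- abs_IZR. apply IZR_le in Hj. rewrite <- INR_IZR_INZ in Hj.
      rewrite plus_INR in Dk. simpl (INR 1) in Dk. pose proof (pos_INR k).
      pose proof (IZR_le _ _ (Z.abs_nonneg j)). pose proof (Rabs_pos phi). nra.
    + rewrite HN, sqrt_pow2 by (apply pow_le; lra). rewrite Tx, Er. auto.
Qed.
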